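(* Let $\mathbf Y=\mathbf A(z)+\mathbf B(z)\mathbf Y$ be an irreducible linear well-founded system. Let $\rho_A,\rho_B,\rho_Y$ be the radii of convergence of $\mathbf A,\mathbf B,\mathbf Y$ (the generating function solution) and $\Sigma_A,\Sigma_B,\Sigma_Y$ their sets of dominant singularities. If the largest real eigenvalue of $\mathbf B(\rho_B)$ is smaller than $1$, let $\rho_C:=+\infty$ and $\Sigma_C:=\emptyset$. Otherwise, there exists a unique $\rho_C\in(0,\rho_B]$ such that the largest real eigenvalue of $\mathbf B(\rho_C)$ is $1$; let $q$ be the gcd of the periods of the entries of $\mathbf B$; set $q_B:=q$ if $q\ne0$, and otherwise let $q_B$ be the gcd of the periods of the diagonal entries of $(\mathrm{Id}-\mathbf B)^{-1}$; and let $\Sigma_C:=\{\rho_C\exp(2i\pi k/q_B)\mid k\in\{0,\dots,q_B-1\}\}$. Then $\rho_Y=\min(\rho_A,\rho_B,\rho_C)$ and \[\Sigma_Y\subset\bigcup_{X\in\{A,B,C\},\ \rho_X=\rho_Y}\Sigma_X.\]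
   Context: A system $\mathbf Y=\mathbf H(z,\mathbf Y)$ with $\mathbf H$ analytic near $\mathbf 0\in\mathbb C^{m+1}$ is well founded when (i) each $H_i$ has nonnegative real Taylor coefficients at $\mathbf 0$; (ii) with $\mathbf U^{[0]}=\mathbf 0$, for $k=0,\dots,m$, $(0,\mathbf U^{[k]})$ lies in the domain of convergence of the Taylor series of $\mathbf H$, so that $\mathbf U^{[k+1]}=\mathbf H(0,\mathbf U^{[k]})$ is defined; (iii) $\partial\mathbf H/\partial\mathbf Y$ at $(0,\mathbf U^{[m]})$ is nilpotent. The generating function solution is the unique solution analytic near $0$ with value $\mathbf U^{[m]}$ at $0$. The system is irreducible if it is well founded, zero-free (no coordinate of the solution identically zero), recursive ($\partial\mathbf H/\partial\mathbf Y$ not nilpotent) and its dependency graph (edge $i\to j$ when $H_i$ depends on $Y_j$) is strongly connected. Here $\mathbf H=\mathbf A(z)+\mathbf B(z)\mathbf Y$ with $\mathbf A$ a vector and $\mathbf B$ a matrix of power series. For a nonzero power series $f$, its period is $\gcd(\mathrm{Supp}(f)-\mathrm{val}(f))$, where $\mathrm{Supp}$ is the set of indices of nonzero coefficients and $\mathrm{val}=\min\mathrm{Supp}$ (the period of a monomial is $0$). The radius of convergence of a vector or matrix is the minimum over its entries, and its dominant singularities are the singularities of its entries on the circle of that radius. *)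

(* Defs.v *)
From HB Require Import structures.
From mathcomp Require Import all_boot all_order all_algebra.
From mathcomp Require Import all_classical all_reals all_analysis.
From mathcomp Require Import complex.

Set Implicit Arguments.
Unset Strict Implicit.
Unset Printing Implicit Defensive.

Import Order.TTheory GRing.Theory Num.Theory.
Import numFieldNormedType.Exports.

Local Open Scope classical_set_scope.
Local Open Scope ring_scope.
Local Open Scope complex_scope.

(* A one-field record rather than [nat -> K], because MathComp-Analysis equips
   the latter with the pointwise product. *)
Record fps (K : Type) := Fps { fps_coef :> nat -> K }.

Lemma fpsP (K : Type) (f g : fps K) : (forall n, f n = g n) -> f = g.
Proof. by case: f g => [f] [g] /= fg; congr Fps; apply/funext. Qed.

HB.instance Definition _ (K : Type) := gen_eqMixin (fps K).
HB.instance Definition _ (K : Type) := gen_choiceMixin (fps K).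

Section FpsRing.
Variable K : comNzRingType.
Implicit Types f g h : fps K.

Definition fps_zero : fps K := Fps (fun=> 0).
Definition fps_one : fps K := Fps (fun n => (n == 0%N)%:R).
Definition fps_opp f : fps K := Fps (fun n => - f n).
Definition fps_add f g : fps K := Fps (fun n => f n + g n).
Definition fps_mul f g : fps K := Fps (fun n => \sum_(i < n.+1) f i * g (n - i)%N).

Fact fps_addA : associative fps_add.
Proof. by move=> f g h; apply: fpsP => n /=; rewrite addrA. Qed.
Fact fps_addC : commutative fps_add.
Proof. by move=> f g; apply: fpsP => n /=; rewrite addrC. Qed.
Fact fps_add0 : left_id fps_zero fps_add.
Proof. by move=> f; apply: fpsP => n /=; rewrite add0r. Qed.
Fact fps_addN : left_inverse fps_zero fps_opp fps_add.
Proof. by move=> f; apply: fpsP => n /=; rewrite addNr. Qed.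

HB.instance Definition _ :=
  GRing.isZmodule.Build (fps K) fps_addA fps_addC fps_add0 fps_addN.

Let trunc N f : {poly K} := \poly_(i < N.+1) f i.

Let coef_trunc N f n : (n <= N)%N -> (trunc N f)`_n = f n.
Proof. by move=> nN; rewrite coef_poly ltnS nN. Qed.

Let coef_truncM N f g n : (n <= N)%N ->
  (trunc N f * trunc N g)`_n = fps_mul f g n.
Proof.
move=> nN; rewrite coefM; apply: eq_bigr => i _.
rewrite !coef_trunc //; first exact: leq_trans (leq_subr _ _) nN.
by rewrite (leq_trans _ nN) // -ltnS.
Qed.

Fact fps_mulC : commutative fps_mul.
Proof.
by move=> f g; apply: fpsP => n; rewrite -!(@coef_truncM n) // mulrC.
Qed.

Fact fps_mulA : associative fps_mul.
Proof.
move=> f g h; apply: fpsP => n.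
transitivity ((trunc n f * (trunc n g * trunc n h))`_n).
  rewrite coefM; apply: eq_bigr => i _.
  by rewrite coef_trunc -1?ltnS // coef_truncM // leq_subr.
rewrite mulrA coefM; apply: eq_bigr => i _.
by rewrite coef_trunc ?leq_subr // coef_truncM // -ltnS.
Qed.

Fact fps_mul1 : left_id fps_one fps_mul.
Proof.
move=> f; apply: fpsP => n /=; rewrite big_ord_recl /= subn0 mul1r.
by rewrite big1 ?addr0 // => i _; rewrite mul0r.
Qed.

Fact fps_mulDl : left_distributive fps_mul fps_add.
Proof.
move=> f g h; apply: fpsP => n /=; rewrite -big_split /=.
by apply: eq_bigr => i _; rewrite mulrDl.
Qed.

Fact fps_one_neq0 : fps_one != 0.
Proof.
apply/eqP => /(congr1 (fun f : fps K => f 0%N)) /= /eqP.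
by rewrite oner_eq0.
Qed.

HB.instance Definition _ := GRing.Zmodule_isComNzRing.Build (fps K)
  fps_mulA fps_mulC fps_mul1 fps_mulDl fps_one_neq0.

Definition fps_unit : {pred fps K} := fun f => `[< exists g, g * f = 1 >].
Definition fps_inv f : fps K :=
  if pselect (exists g, g * f = 1) is left e then projT1 (cid e) else f.

Fact fps_mulV : {in fps_unit, left_inverse 1 fps_inv *%R}.
Proof.
move=> f /asboolP fU; rewrite /fps_inv; case: pselect => // e.
exact: projT2 (cid e).
Qed.
Fact fps_unitP f g : g * f = 1 -> fps_unit f.
Proof. by move=> gf; apply/asboolP; exists g. Qed.
Fact fps_inv_out : {in [predC fps_unit], fps_inv =1 id}.
Proof.
move=> f /negP fU; rewrite /fps_inv; case: pselect => // e.
by case: fU; apply/asboolP.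
Qed.

HB.instance Definition _ := GRing.ComNzRing_hasMulInverse.Build (fps K)
  fps_mulV fps_unitP fps_inv_out.

End FpsRing.

Definition is_nilpotent (S : pzRingType) (x : S) : Prop := exists k, x ^+ k = 0.

Section Evaluation.
Variable K : numFieldType.

Definition fps_series (f : fps K) (z : K) : K ^nat :=
  [series f n * z ^+ n]_n.

Definition fps_cvg (f : fps K) (z : K) : Prop := cvgn (fps_series f z).

Definition fps_eval (f : fps K) (z : K) : K := limn (fps_series f z).

Definition mx_cvg p q (M : 'M[fps K]_(p, q)) (z : K) : Prop :=
  forall i j, fps_cvg (M i j) z.

Definition mx_eval p q (M : 'M[fps K]_(p, q)) (z : K) : 'M[K]_(p, q) :=
  map_mx (fps_eval^~ z) M.

End Evaluation.

Section Period.
Variable K : nzRingType.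
Implicit Types f : fps K.

(* Greatest for divisibility, so that the gcd of {0} is 0. *)
Definition gcd_set (S : set nat) : nat :=
  get [set d | (forall s, S s -> (d %| s)%N) /\
               (forall e, (forall s, S s -> (e %| s)%N) -> (e %| d)%N)].

Definition fps_supp f : set nat := [set n | f n != 0].

Definition fps_val f : nat :=
  get [set v | fps_supp f v /\ forall n, fps_supp f n -> (v <= n)%N].

Definition fps_period f : nat :=
  gcd_set [set (n - fps_val f)%N | n in fps_supp f].

End Period.

Section ComplexAnalysis.
Variable R : realType.
Local Notation C := R[i].
Local Notation normc := (@ComplexField.Normc.normc R).

Definition fps_radius (f : fps C) : \bar R :=
  ereal_sup [set (normc z)%:E | z in [set z : C | fps_cvg f z]].

Definition mx_radius p q (M : 'M[fps C]_(p, q)) : \bar R :=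
  \big[mine/+oo%E]_(i < p) \big[mine/+oo%E]_(j < q) fps_radius (M i j).

(* The sum of f on its open disc of convergence continues analytically to a
   neighbourhood of z0; g is the Taylor series at z0 of the continuation.
   Only meant for z0 on the circle of convergence or inside it. *)
Definition regular_at (f : fps C) (z0 : C) : Prop :=
  exists g : fps C, exists2 r : R, 0 < r &
    forall z : C, normc (z - z0) < r ->
      fps_cvg g (z - z0) /\
      (((normc z)%:E < fps_radius f)%E -> fps_eval f z = fps_eval g (z - z0)).

Definition dominant_sing p q (M : 'M[fps C]_(p, q)) : set C :=
  [set z | (normc z)%:E = mx_radius M /\ exists i j, ~ regular_at (M i j) z].

Definition largest_real_eigenvalue n (M : 'M[C]_n) (l : R) : Prop :=
  eigenvalue M l%:C /\ forall l' : R, eigenvalue M l'%:C -> l' <= l.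

Definition expi (t : R) : C := cos t +i* sin t.

End ComplexAnalysis.

Section LinearSystem.
Variables (R : realType) (m : nat).
Local Notation C := R[i].
Local Notation normc := (@ComplexField.Normc.normc R).
Implicit Types (A Y : 'cV[fps C]_m) (B : 'M[fps C]_m).

Definition lin_H A B (z : C) (y : 'cV[C]_m) : 'cV[C]_m :=
  mx_eval A z + mx_eval B z *m y.

(* H is affine in y, so the domain of convergence of its Taylor series is a
   disc in z times all of C^m. *)
Definition lin_domain A B : set (C * 'cV[C]_m) :=
  [set p | ((normc p.1)%:E < mx_radius A)%E /\
           ((normc p.1)%:E < mx_radius B)%E].

(* The matrix dH/dY at the point (z, y); it does not depend on y. *)
Definition lin_jacobian B (z : C) (y : 'cV[C]_m) : 'M[C]_m := mx_eval B z.

Fixpoint lin_U A B (k : nat) : 'cV[C]_m :=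
  if k is k'.+1 then lin_H A B 0 (lin_U A B k') else 0.

(* The order of R[i] is partial: [0 <= c] says that c is real and
   nonnegative. *)
Definition wf_system A B : Prop :=
  [/\ (0 < mx_radius A)%E /\ (0 < mx_radius B)%E,
      (forall i n, 0 <= A i 0 n) /\ (forall i j n, 0 <= B i j n),
      forall k, (k <= m)%N -> lin_domain A B (0, lin_U A B k)
    & is_nilpotent (lin_jacobian B 0 (lin_U A B m))].

(* Analytic germs at 0 are represented by their Taylor series. *)
Definition gf_solution A B Y : Prop :=
  [/\ (0 < mx_radius Y)%E, Y = A + B *m Y & mx_eval Y 0 = lin_U A B m].

Definition zero_free A B : Prop :=
  forall Y, gf_solution A B Y -> forall i, Y i 0 != 0.

Definition dependency B : rel 'I_m := [rel i j | B i j != 0].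

Definition irreducible_system A B : Prop :=
  [/\ wf_system A B, zero_free A B, ~ is_nilpotent B
    & forall i j, connect (dependency B) i j].

(* The largest real eigenvalue of B(rho_B) is smaller than 1. This includes
   that rho_B is finite and that B converges there; otherwise the eigenvalue
   counts as +oo. *)
Definition subcritical B : Prop :=
  exists r : R, [/\ mx_radius B = r%:E, mx_cvg B r%:C &
    exists2 l : R, largest_real_eigenvalue (mx_eval B r%:C) l & l < 1].

Definition is_rhoC B (r : R) : Prop :=
  [/\ 0 < r, (r%:E <= mx_radius B)%E, mx_cvg B r%:C
    & largest_real_eigenvalue (mx_eval B r%:C) 1].

(* Zero entries have no period and are left out. *)
Definition gcd_periods B : nat :=
  \big[gcdn/0%N]_i \big[gcdn/0%N]_(j | B i j != 0) fps_period (B i j).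

Definition qB B : nat :=
  if gcd_periods B != 0%N then gcd_periods B
  else \big[gcdn/0%N]_i fps_period (invmx (1%:M - B) i i).

Definition SigmaC B (r : R) : set C :=
  [set r%:C * expi (2 * pi * k%:R / (qB B)%:R) | k in `I_(qB B)].

End LinearSystem.

(* Main.v *)
(* For x > 0 the matrix B(x) is nonnegative and irreducible, with a Perron
   eigenvalue l(x) that strictly increases with x and is the largest real
   eigenvalue.  The critical point r is the supremum of the x at which
   B(x) u <= u for some positive vector u: going round a cycle of the dependency
   graph bounds the entries of B(x) for those x, so that B(r) converges;
   l(r) <= 1 by left continuity; and if l(r) < 1 then r is the radius of B,
   since by convexity B(x) u <= u would survive slightly beyond r.
   When l(x) < 1, pairing Y = A + B Y with a left Perron eigenvector bounds the
   partial sums of Y at x; when l(x) = 1, the same pairing leaves A = 0 if Y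
   converges at x.  Hence the radius of Y is min(rho_A, r).
   At a point z of that circle where A and B are regular, Y = (1 - B)^-1 A is
   regular unless y B(z) = y for some y <> 0.  Then |y| <= |y| B(|z|) is an
   equality, so that l(|z|) = 1, and every nonzero coefficient of index n of
   B_ij satisfies d_i w^n = d_j, with w = z/|z| and d_i = y_i/|y_i|.  The
   resolvent (1 - B)^-1 inherits these relations, whence w^(q_B) = 1. *)
Require Import Defs.
From HB Require Import structures.
From mathcomp Require Import all_boot all_order all_algebra.
From mathcomp Require Import all_classical all_reals all_analysis.
From mathcomp Require Import complex ring lra.
Import Order.TTheory GRing.Theory Num.Theory.
Import numFieldNormedType.Exports.
Import ComplexField.Normc.
Local Open Scope classical_set_scope.
Local Open Scope ring_scope.

Set Implicit Arguments.
Unset Strict Implicit.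
Unset Printing Implicit Defensive.

Section Modulus.
Variable R : rcfType.
Local Notation Re := (@complex.Re R).
Local Notation Im := (@complex.Im R).
Local Open Scope complex_scope.
Implicit Types z w : R[i].

Lemma normr_normc z : `|z| = (normc z)%:C.
Proof. by case: z. Qed.

Lemma normc_ge0 z : 0 <= normc z.
Proof. exact: (@normr_ge0 _ (Rcomplex R)). Qed.

Lemma normc_eq0 z : (normc z == 0) = (z == 0).
Proof. exact: (@normr_eq0 _ (Rcomplex R)). Qed.

Lemma normc_gt0 z : (0 < normc z) = (z != 0).
Proof. exact: (@normr_gt0 _ (Rcomplex R)). Qed.

Lemma normc_distC z w : normc (z - w) = normc (w - z).
Proof. exact: (@distrC _ (Rcomplex R)). Qed.

Lemma normc_dist_dist z w : `|normc z - normc w| <= normc (z - w).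
Proof. exact: (@ler_dist_dist _ (Rcomplex R)). Qed.

Lemma normc_sum (I : Type) (r : seq I) (P : pred I) (F : I -> R[i]) :
  normc (\sum_(i <- r | P i) F i) <= \sum_(i <- r | P i) normc (F i).
Proof. exact: (@ler_norm_sum _ (Rcomplex R)). Qed.

Lemma normcX z n : normc (z ^+ n) = normc z ^+ n.
Proof. by apply: complexI; rewrite rmorphXn /= -!normr_normc normrX. Qed.

Lemma gt0_realC_neq0 (x : R) : 0 < x -> x%:C != 0.
Proof. by move=> x0; rewrite gt_eqF // ltcR. Qed.

Lemma normc_real (x : R) : normc x%:C = `|x|.
Proof. by rewrite /= expr0n addr0 sqrtr_sqr. Qed.

Lemma ge0_normc z : 0 <= z -> (normc z)%:C = z.
Proof. by move=> z0; rewrite -normr_normc ger0_norm. Qed.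

Lemma le_normc z w : 0 <= z -> z <= w -> normc z <= normc w.
Proof. by move=> z0 zw; rewrite -lecR !ge0_normc // (le_trans z0). Qed.

Lemma normc_Re z : `|Re z| <= normc z.
Proof. by rewrite -lecR -normr_normc; exact: normc_ge_Re. Qed.

Lemma normc_Im z : `|Im z| <= normc z.
Proof. by case: z => a b /=; rewrite -sqrtr_sqr ler_wsqrtr // lerDr sqr_ge0. Qed.

Lemma normc_le_Re_Im z : normc z <= `|Re z| + `|Im z|.
Proof.
case: z => a b /=; rewrite -(@ler_sqr _ (Num.sqrt _)) ?nnegrE ?addr_ge0 ?sqrtr_ge0 //.
rewrite sqr_sqrtr ?addr_ge0 ?sqr_ge0 // sqrrD !real_normK ?num_real //.
by rewrite addrAC lerDl mulrn_wge0 ?mulr_ge0.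
Qed.

Lemma Re_le_normc z : Re z <= normc z.
Proof. exact: le_trans (ler_norm _) (normc_Re z). Qed.

Lemma normc_le_Re z : normc z <= Re z -> (normc z)%:C = z.
Proof.
move=> zRe; apply: ge0_normc.
have {zRe} zRe : normc z = Re z by apply/eqP; rewrite eq_le zRe Re_le_normc.
have Re0 : 0 <= Re z by rewrite -zRe normc_ge0.
case: z zRe Re0 => a b /= ab a0.
have /eqP : a ^+ 2 + b ^+ 2 = a ^+ 2 by rewrite -{2}ab sqr_sqrtr ?addr_ge0 ?sqr_ge0.
by rewrite addrC -subr_eq0 addrK sqrf_eq0 => /eqP ->; rewrite lecE /= eqxx.
Qed.

Lemma Re_sum (I : Type) (r : seq I) (F : I -> R[i]) :
  Re (\sum_(i <- r) F i) = \sum_(i <- r) Re (F i).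
Proof. exact: (raddf_sum (Re : {additive Rcomplex R -> R})). Qed.

End Modulus.

Section ComplexLimits.
Variables (R : realType) (T : Type) (F : set_system T).
Context {FF : Filter F}.
Local Notation C := (R[i] : numFieldType).
Local Notation Re := (@complex.Re R).
Local Notation Im := (@complex.Im R).
Local Open Scope complex_scope.
Implicit Types (u v : T -> C) (l : C) (e : T -> R).

Lemma cvg_normc_distP u l :
  u @ F --> l <-> (normc (u x - l) @[x --> F] --> (0 : R)).
Proof.
split=> /cvgrPdist_lt ul; apply/cvgrPdist_lt => e e0.
  have /ul : 0 < e%:C by rewrite ltcR.
  apply: filterS => x; rewrite normr_normc ltcR sub0r normrN.
  by rewrite ger0_norm ?normc_ge0 // normc_distC.
have eE : e = (Re e)%:C by rewrite RRe_real // gtr0_real.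
have /ul : 0 < Re e by rewrite -ltcR -eE.
apply: filterS => x; rewrite eE normr_normc ltcR sub0r normrN.
by rewrite ger0_norm ?normc_ge0 // normc_distC.
Qed.

Lemma cvgc_dist_squeeze u v l e : v @ F --> l ->
  (\forall x \near F, normc (u x - v x) <= e x) -> e @ F --> (0 : R) -> u @ F --> l.
Proof.
move=> /cvg_normc_distP vl uve e0; apply/cvg_normc_distP.
apply: (@squeeze_cvgr _ _ _ _ (fun=> 0) (fun x => e x + normc (v x - l))).
- apply: filterS uve => x uvx; rewrite normc_ge0 /= -(subrK (v x) (u x)) -addrA.
  by rewrite (le_trans (le_normcD _ _)) // lerD2r.
- exact: cvg_cst.
- by rewrite -(addr0 0); exact: cvgD.
Qed.

Lemma cvgc_squeeze u l e : (\forall x \near F, normc (u x - l) <= e x) ->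
  e @ F --> (0 : R) -> u @ F --> l.
Proof. by apply: cvgc_dist_squeeze; exact: cvg_cst. Qed.

Lemma cvg_normc u l : u @ F --> l -> normc (u x) @[x --> F] --> normc l.
Proof.
move=> /cvg_normc_distP ul; apply/cvgrPdist_le => e e0.
move/cvgrPdist_le: ul => /(_ e e0); apply: filterS => x.
rewrite sub0r normrN ger0_norm ?normc_ge0 //; apply: le_trans.
by rewrite distrC normc_dist_dist.
Qed.

Lemma cvg_Re_Im u l : Re (u x) @[x --> F] --> Re l ->
  Im (u x) @[x --> F] --> Im l -> u @ F --> l.
Proof.
move=> ure uim.
apply: (@cvgc_squeeze _ _ (fun x => `|Re (u x) - Re l| + `|Im (u x) - Im l|)).
  apply: nearW => x; apply: le_trans (normc_le_Re_Im _) _.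
  by case: (u x) => a b; case: (l).
by rewrite -(addr0 0); apply: cvgD; apply/norm_cvg0P/subr_cvg0.
Qed.

End ComplexLimits.

(** * Formal power series *)

Section PowerSeriesAlgebra.
Variable K : comNzRingType.
Implicit Types f g h : fps K.

Lemma fps_mulE f g n : (f * g) n = \sum_(i < n.+1) f i * g (n - i)%N.
Proof. by []. Qed.

Lemma fps_sumE (I : Type) (r : seq I) (P : pred I) (F : I -> fps K) n :
  (\sum_(i <- r | P i) F i) n = \sum_(i <- r | P i) F i n.
Proof. by elim/big_rec2: _ => [//|i x y _ <-]. Qed.

Lemma mx_fps_mulE m p q (M : 'M[fps K]_(m, p)) (N : 'M[fps K]_(p, q)) i j n :
  (M *m N) i j n = \sum_k \sum_(a < n.+1) M i k a * N k j (n - a)%N.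
Proof. by rewrite mxE fps_sumE. Qed.

Lemma fps_neq0P f : reflect (exists n, f n != 0) (f != 0).
Proof.
apply: (iffP idP) => [/eqP f0|[n]]; last by apply: contraNneq => ->.
apply/not_existsP => fn; apply: f0; apply: fpsP => n.
by apply/eqP; rewrite -[_ == _]negbK; apply/negP; exact: fn.
Qed.

Definition fps_coef0 f : K := f 0%N.

Fact fps_coef0_is_zmod_morphism : zmod_morphism fps_coef0.
Proof. by []. Qed.

Fact fps_coef0_is_monoid_morphism : monoid_morphism fps_coef0.
Proof. by split => // f g; rewrite /fps_coef0 fps_mulE big_ord1. Qed.

HB.instance Definition _ :=
  GRing.isZmodMorphism.Build (fps K) K fps_coef0 fps_coef0_is_zmod_morphism.
HB.instance Definition _ :=
  GRing.isMonoidMorphism.Build (fps K) K fps_coef0 fps_coef0_is_monoid_morphism.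

Definition fpsC (c : K) : fps K := Fps (fun n => if n is 0%N then c else 0).

Fact fpsC_is_zmod_morphism : zmod_morphism fpsC.
Proof. by move=> a b; apply: fpsP => -[|n] //=; rewrite subr0. Qed.

Fact fpsC_is_monoid_morphism : monoid_morphism fpsC.
Proof.
split=> [|a b]; apply: fpsP => -[|n] //; rewrite fps_mulE; first by rewrite big_ord1.
by rewrite big1 // => -[[|i] ilt] _; rewrite /= ?mulr0 ?mul0r.
Qed.

HB.instance Definition _ :=
  GRing.isZmodMorphism.Build K (fps K) fpsC fpsC_is_zmod_morphism.
HB.instance Definition _ :=
  GRing.isMonoidMorphism.Build K (fps K) fpsC fpsC_is_monoid_morphism.

Definition fps_nderivn f k : fps K := Fps (fun n => f (n + k)%N *+ 'C(n + k, k)).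

End PowerSeriesAlgebra.

Section NeumannSeries.
Variables (K : comNzRingType) (m : nat).
Implicit Types B : 'M[fps K]_m.

Lemma mulmx_coef_eq0 p q r (M : 'M[fps K]_(p, q)) (N : 'M[fps K]_(q, r)) n :
  (forall i j a, (a <= n)%N -> M i j a = 0) -> forall i j, (M *m N) i j n = 0.
Proof.
move=> M0 i j; rewrite mx_fps_mulE big1 // => k _; rewrite big1 // => a _.
by rewrite M0 ?mul0r // -ltnS.
Qed.

Lemma exp_coef_eq0 B k : map_mx (@fps_coef0 K) B ^+ k = 0 ->
  forall t h i j n, (k * t <= h)%N -> (n < t)%N -> (B ^+ h) i j n = 0.
Proof.
move=> Bk t h i j n /subnKC <- nt; rewrite exprD; apply: mulmx_coef_eq0 => {}i {}j a an.
rewrite exprM; move: (leq_ltn_trans an nt) => {an nt n}.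
elim: t i j a => // t IH i j a; rewrite ltnS => at_; rewrite exprS.
rewrite -[_ * _]/(_ *m _) mx_fps_mulE big1 // => l _; rewrite big1 // => b _.
have [b0|b0] := posnP b; last first.
  by rewrite IH ?mulr0 // (leq_trans _ at_) // ltn_subrL b0 (leq_trans b0) // -ltnS.
have Bk0 : (B ^+ k) i l 0%N = 0.
  by move/matrixP: Bk => /(_ i l); rewrite -rmorphXn !mxE.
by rewrite b0 Bk0 mul0r.
Qed.

Lemma neumann_expansion p (A Y : 'M[fps K]_(m, p)) B N : Y = A + B *m Y ->
  Y = (\sum_(h < N) B ^+ h) *m A + B ^+ N *m Y.
Proof.
move=> YE; elim: N => [|N IH]; first by rewrite big_ord0 mul0mx add0r mul1mx.
rewrite {1}IH {1}YE big_ord_recr /= mulmxDl mulmxDr addrA; congr (_ + _).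
by rewrite exprSr mulmxA.
Qed.

Lemma unitmx_1B B : is_nilpotent (map_mx (@fps_coef0 K) B) -> 1%:M - B \in unitmx.
Proof.
move=> [k /exp_coef_eq0 Bh].
pose S N := \sum_(h < N) B ^+ h.
pose G : 'M[fps K]_m := \matrix_(i, j) Fps (fun n => S (k * n.+1)%N i j n).
have GS n i j a : (a <= n)%N -> G i j a = S (k * n.+1)%N i j a.
  move=> an; rewrite mxE /= /S -(subnKC (leq_mul (leqnn k) (an : (a.+1 <= n.+1)%N))).
  rewrite big_split_ord [in RHS]mxE [RHS]/= [X in _ + X](_ : _ = 0) ?addr0 //.
  rewrite summxE fps_sumE big1 // => h _.
  by apply: Bh (leq_addr _ _) (ltnSn a).
suff /mulmx1_unit[uB _] : (1%:M - B) *m G = 1%:M by exact: uB.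
apply/matrixP => i j; apply: fpsP => n.
transitivity (((1%:M - B) *m S (k * n.+1)%N) i j n).
  rewrite !mx_fps_mulE; apply: eq_bigr => l _; apply: eq_bigr => a _.
  by rewrite (GS n) // leq_subr.
have -> : (1%:M - B) *m S (k * n.+1)%N = 1%:M - B ^+ (k * n.+1).
  by rewrite -[_ *m _]/((1 - B) * _) -opprB mulNr -subrX1 opprB.
have Bn : (B ^+ (k * n.+1)) i j n = 0 by apply: (Bh n.+1).
by rewrite mxE [fun_of_matrix (- _) i j]mxE [LHS]/= Bn subr0.
Qed.

Lemma invmx_1BE B : is_nilpotent (map_mx (@fps_coef0 K) B) ->
  invmx (1%:M - B) = 1%:M + B *m invmx (1%:M - B).
Proof.
move=> /unitmx_1B /mulmxV; rewrite mulmxBl mul1mx => /eqP.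
by rewrite subr_eq => /eqP.
Qed.

Lemma exists_nonconstant_entry B :
  is_nilpotent (map_mx (@fps_coef0 K) B) -> ~ is_nilpotent B ->
  exists i j n, (0 < n)%N /\ B i j n != 0.
Proof.
move=> [k B0k] Brec; apply: contrapT => constant; apply: Brec; exists k.
suff -> : B = map_mx (@fpsC K) (map_mx (@fps_coef0 K) B) by rewrite -rmorphXn B0k raddf0.
apply/matrixP => i j; rewrite !mxE; apply: fpsP => -[//|n] /=; apply: contrapT.
by move/eqP => Bn; apply: constant; exists i, j, n.+1.
Qed.

End NeumannSeries.

(** * Evaluation of power series *)

Section Evaluation.
Variable K : numFieldType.
Implicit Types (f g : fps K) (z w : K).

Definition fps_nneg f : Prop := forall n, 0 <= f n.

Lemma fps_nnegM f g : fps_nneg f -> fps_nneg g -> fps_nneg (f * g).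
Proof. by move=> f0 g0 n; rewrite fps_mulE sumr_ge0 // => i _; rewrite mulr_ge0. Qed.

Lemma fps_seriesE f z N : fps_series f z N = \sum_(k < N) f k * z ^+ k.
Proof. by rewrite /fps_series /series /= big_mkord. Qed.

Lemma fps_seriesS f z N :
  fps_series f z N.+1 = fps_series f z N + f N * z ^+ N.
Proof. by rewrite !fps_seriesE big_ord_recr. Qed.

Lemma fps_seriesSl f z N :
  fps_series f z N.+1 = f 0%N + \sum_(k < N) f k.+1 * z ^+ k.+1.
Proof. by rewrite fps_seriesE big_ord_recl mulr1. Qed.

Lemma fps_seriesM f g z N : fps_series (f * g) z N =
  \sum_(i < N) f i * z ^+ i * fps_series g z (N - i)%N.
Proof.
elim: N => [|N IH]; first by rewrite fps_seriesE !big_ord0.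
rewrite fps_seriesS IH fps_mulE [in LHS]big_ord_recr [RHS]big_ord_recr /=.
rewrite subnn subSnn fps_seriesSl big_ord0 addr0 mulrDl addrA mulr_suml.
rewrite -big_split /=; congr (_ + _); last by ring.
apply: eq_bigr => i _; rewrite (subSn (ltnW (ltn_ord i))) fps_seriesS mulrDr.
by rewrite mulrACA -exprD subnKC // ltnW.
Qed.

Lemma fps_series_taylor f z w N : fps_series f (z + w) N =
  \sum_(k < N) w ^+ k * fps_series (fps_nderivn f k) z (N - k)%N.
Proof.
elim: N => [|N IH]; first by rewrite fps_seriesE !big_ord0.
rewrite fps_seriesS IH [RHS]big_ord_recr /= subSnn fps_seriesSl big_ord0 addr0.
rewrite exprDn big_ord_recr /= subnn mul1r binn mulr1n mulrDr addrA; congr (_ + _).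
  rewrite mulr_sumr -big_split /=; apply: eq_bigr => k _.
  rewrite (subSn (ltnW (ltn_ord k))) fps_seriesS mulrDr /= subnK ?(ltnW (ltn_ord k)) //.
  by congr (_ + _); rewrite mulrnAl !mulrnAr; congr (_ *+ _); ring.
by rewrite /= add0n mulr1n mulrC.
Qed.

Lemma fps_eval_eq f z l : fps_series f z @ \oo --> l -> fps_eval f z = l.
Proof. exact: (cvg_lim (@norm_hausdorff _ _)). Qed.

Lemma cvg_fps_seriesC c z : fps_series (fpsC c) z @ \oo --> c.
Proof.
apply: cvg_near_cst; exists 1%N => // -[//|N] _.
by rewrite fps_seriesSl big1 ?addr0 // => i _; rewrite mul0r.
Qed.

Lemma fps_cvgC c z : fps_cvg (fpsC c) z.
Proof. by apply: cvgP; exact: cvg_fps_seriesC. Qed.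

Lemma fps_evalC c z : fps_eval (fpsC c) z = c.
Proof. by apply: fps_eval_eq; exact: cvg_fps_seriesC. Qed.

Lemma cvg_fps_series0 f : fps_series f 0 @ \oo --> f 0%N.
Proof.
apply: cvg_near_cst; exists 1%N => // -[//|N] _.
by rewrite fps_seriesSl big1 ?addr0 // => i _; rewrite exprS mul0r mulr0.
Qed.

Lemma fps_cvg0 f : fps_cvg f 0.
Proof. by apply: cvgP; exact: cvg_fps_series0. Qed.

Lemma fps_eval0 f : fps_eval f 0 = f 0%N.
Proof. by apply: fps_eval_eq; exact: cvg_fps_series0. Qed.

Lemma fps_seriesD f g z : fps_series (f + g) z = fps_series f z \+ fps_series g z.
Proof.
apply/funext => N; rewrite /= !fps_seriesE -big_split.
by apply: eq_bigr => k _ /=; rewrite mulrDl.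
Qed.

Lemma fps_seriesN f z : fps_series (- f) z = \- fps_series f z.
Proof.
apply/funext => N; rewrite /= !fps_seriesE -sumrN.
by apply: eq_bigr => k _ /=; rewrite mulNr.
Qed.

Lemma fps_cvgD f g z : fps_cvg f z -> fps_cvg g z -> fps_cvg (f + g) z.
Proof. by rewrite /fps_cvg fps_seriesD; exact: is_cvgD. Qed.

Lemma fps_cvgN f z : fps_cvg f z -> fps_cvg (- f) z.
Proof. by rewrite /fps_cvg fps_seriesN; exact: is_cvgN. Qed.

Lemma fps_evalD f g z : fps_cvg f z -> fps_cvg g z ->
  fps_eval (f + g) z = fps_eval f z + fps_eval g z.
Proof. by move=> fz gz; apply: fps_eval_eq; rewrite fps_seriesD; exact: cvgD. Qed.

Lemma fps_evalN f z : fps_cvg f z -> fps_eval (- f) z = - fps_eval f z.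
Proof. by move=> fz; apply: fps_eval_eq; rewrite fps_seriesN; exact: cvgN. Qed.

Lemma fps_cvg_sum (I : Type) (r : seq I) (P : pred I) (F : I -> fps K) z :
  (forall i, P i -> fps_cvg (F i) z) -> fps_cvg (\sum_(i <- r | P i) F i) z.
Proof.
move=> Fz; elim/big_ind: _ => //; first by rewrite -(raddf0 (@fpsC _)); exact: fps_cvgC.
by move=> f g; exact: fps_cvgD.
Qed.

Lemma fps_eval_sum (I : Type) (r : seq I) (P : pred I) (F : I -> fps K) z :
  (forall i, P i -> fps_cvg (F i) z) ->
  fps_eval (\sum_(i <- r | P i) F i) z = \sum_(i <- r | P i) fps_eval (F i) z.
Proof.
move=> Fz; elim: r => [|i r IH]; first by rewrite !big_nil -(raddf0 (@fpsC _)) fps_evalC.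
rewrite !big_cons; case: ifP => // Pi; rewrite fps_evalD ?IH //; first exact: Fz.
exact: fps_cvg_sum.
Qed.

End Evaluation.

Section MatrixEvaluation.
Variables (K : numFieldType) (p q : nat).
Implicit Types (M N : 'M[fps K]_(p, q)) (z : K).

Lemma mx_evalD M N z : mx_cvg M z -> mx_cvg N z ->
  mx_eval (M + N) z = mx_eval M z + mx_eval N z.
Proof. by move=> Mz Nz; apply/matrixP => i j; rewrite !mxE fps_evalD. Qed.

Lemma mx_eval0 M : mx_eval M 0 = map_mx (@fps_coef0 K) M.
Proof. by apply/matrixP => i j; rewrite !mxE fps_eval0. Qed.

End MatrixEvaluation.

Lemma mx_eval1 (K : numFieldType) m z : mx_eval (1%:M : 'M[fps K]_m) z = 1%:M.
Proof. by apply/matrixP => i j; rewrite !mxE -(rmorph_nat (@fpsC K)) fps_evalC. Qed.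

Section NonnegativeMatrices.
Variable K : numFieldType.

Definition mx_nneg p q (M : 'M[fps K]_(p, q)) : Prop := forall i j, fps_nneg (M i j).

Lemma mx_nnegM p q r (M : 'M[fps K]_(p, q)) (N : 'M[fps K]_(q, r)) :
  mx_nneg M -> mx_nneg N -> mx_nneg (M *m N).
Proof.
move=> M0 N0 i j n; rewrite mx_fps_mulE sumr_ge0 // => k _.
by rewrite sumr_ge0 // => a _; rewrite mulr_ge0 ?M0 ?N0.
Qed.

Lemma mx_nneg1 m : mx_nneg (1%:M : 'M[fps K]_m).
Proof.
by move=> i j n; rewrite mxE -(rmorph_nat (@fpsC K)); case: n => [|n]; rewrite /= ?ler0n.
Qed.

End NonnegativeMatrices.

Section NonnegativeSeries.
Variable R : realType.
Implicit Types (f g : fps R) (x y t : R).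

Lemma fps_nneg_term f x n : fps_nneg f -> 0 <= x -> 0 <= f n * x ^+ n.
Proof. by move=> f0 x0; rewrite mulr_ge0 ?exprn_ge0. Qed.

Lemma fps_series_ge0 f x N : fps_nneg f -> 0 <= x -> 0 <= fps_series f x N.
Proof.
by move=> f0 x0; rewrite fps_seriesE sumr_ge0 // => k _; exact: fps_nneg_term.
Qed.

Lemma fps_series_nondecreasing f x : fps_nneg f -> 0 <= x ->
  nondecreasing_seq (fps_series f x).
Proof.
move=> f0 x0; apply/nondecreasing_seqP => n.
by rewrite fps_seriesS lerDl fps_nneg_term.
Qed.

Lemma ler_fps_series f g x y N : fps_nneg f -> (forall n, f n <= g n) ->
  0 <= x -> x <= y -> fps_series f x N <= fps_series g y N.
Proof.
move=> f0 fg x0 xy; rewrite !fps_seriesE; apply: ler_sum => k _.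
by rewrite ler_pM ?exprn_ge0 // lerXn2r // nnegrE (le_trans x0).
Qed.

Lemma fps_series_bounded_cvg f x b : fps_nneg f -> 0 <= x ->
  (forall N, fps_series f x N <= b) -> fps_cvg f x.
Proof.
move=> f0 x0 fb; apply: nondecreasing_is_cvgn.
  exact: fps_series_nondecreasing.
by exists b => _ [N _ <-].
Qed.

Lemma fps_series_le_eval f x N : fps_nneg f -> 0 <= x -> fps_cvg f x ->
  fps_series f x N <= fps_eval f x.
Proof.
by move=> f0 x0 fx; apply: nondecreasing_cvgn_le => //; exact: fps_series_nondecreasing.
Qed.

Lemma fps_eval_le f x b : fps_cvg f x -> (forall N, fps_series f x N <= b) ->
  fps_eval f x <= b.
Proof. by move=> fx fb; apply: limr_le => //; exact: nearW. Qed.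

Lemma fps_eval_ge0 f x : fps_nneg f -> 0 <= x -> fps_cvg f x -> 0 <= fps_eval f x.
Proof.
move=> f0 x0 fx; apply: le_trans (fps_series_le_eval 0 f0 x0 fx).
exact: fps_series_ge0.
Qed.

Lemma fps_nneg_cvg_le f g x y : fps_nneg f -> (forall n, f n <= g n) ->
  0 <= x -> x <= y -> fps_cvg g y -> fps_cvg f x.
Proof.
move=> f0 fg x0 xy gy; apply: (fps_series_bounded_cvg (b := fps_eval g y)) => // N.
apply: le_trans (fps_series_le_eval N _ _ gy); last exact: le_trans xy.
  exact: ler_fps_series.
by move=> n; exact: le_trans (fg n).
Qed.

Lemma ler_fps_eval f g x y : fps_nneg f -> (forall n, f n <= g n) ->
  0 <= x -> x <= y -> fps_cvg g y -> fps_eval f x <= fps_eval g y.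
Proof.
move=> f0 fg x0 xy gy; apply: fps_eval_le; first exact: fps_nneg_cvg_le gy.
move=> N; apply: le_trans (fps_series_le_eval N _ _ gy); last exact: le_trans xy.
  exact: ler_fps_series.
by move=> n; exact: le_trans (fg n).
Qed.

Lemma fps_term_le_eval f x n : fps_nneg f -> 0 <= x -> fps_cvg f x ->
  f n * x ^+ n <= fps_eval f x.
Proof.
move=> f0 x0 fx; apply: le_trans (fps_series_le_eval n.+1 f0 x0 fx).
by rewrite fps_seriesS lerDr fps_series_ge0.
Qed.

Lemma fps_eval_gt0 f x n : fps_nneg f -> 0 < x -> fps_cvg f x -> f n != 0 ->
  0 < fps_eval f x.
Proof.
move=> f0 x0 fx fn; apply: lt_le_trans (fps_term_le_eval n f0 (ltW x0) fx).
by rewrite mulr_gt0 ?exprn_gt0 // lt_def fn f0.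
Qed.

Lemma fps_cvg_geometric f x y b : fps_nneg f -> 0 <= x -> x < y ->
  (forall n, f n * y ^+ n <= b) -> fps_cvg f x.
Proof.
move=> f0 x0 xy fb; have y0 : 0 < y by exact: le_lt_trans xy.
have xy0 : 0 <= x / y by rewrite divr_ge0 // ltW.
have b0 : 0 <= b by apply: le_trans (fb 0%N); rewrite fps_nneg_term // ltW.
apply: (@series_le_cvg _ _ (geometric b (x / y))) => [n|n|n|].
- exact: fps_nneg_term.
- exact: geometric_ge0.
- rewrite /geometric /= expr_div_n mulrA ler_pdivlMr ?exprn_gt0 //.
  by rewrite mulrAC ler_wpM2r ?exprn_ge0.
by apply: is_cvg_geometric_series; rewrite ger0_norm // ltr_pdivrMr // mul1r.
Qed.

Lemma ler_fps_seriesM f g x N : fps_nneg f -> fps_nneg g -> 0 <= x ->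
  fps_series (f * g) x N <= fps_series f x N * fps_series g x N.
Proof.
move=> f0 g0 x0; rewrite fps_seriesM fps_seriesE mulr_suml; apply: ler_sum => i _.
rewrite ler_wpM2l ?fps_nneg_term //; apply: fps_series_nondecreasing => //.
exact: leq_subr.
Qed.

Lemma ler_fps_series_doubleM f g x N : fps_nneg f -> fps_nneg g -> 0 <= x ->
  fps_series f x N * fps_series g x N <= fps_series (f * g) x (N + N)%N.
Proof.
move=> f0 g0 x0; rewrite fps_seriesM big_split_ord /= fps_seriesE mulr_suml.
apply: ler_wpDr.
  by apply: sumr_ge0 => i _; rewrite mulr_ge0 ?fps_nneg_term ?fps_series_ge0.
apply: ler_sum => i _; rewrite ler_wpM2l ?fps_nneg_term //.
by apply: fps_series_nondecreasing => //; rewrite -addnBA ?leq_addr // ltnW.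
Qed.

Lemma fps_nneg_cvgM f g x : fps_nneg f -> fps_nneg g -> 0 <= x ->
  fps_cvg f x -> fps_cvg g x -> fps_cvg (f * g) x.
Proof.
move=> f0 g0 x0 fx gx.
apply: (fps_series_bounded_cvg (b := fps_eval f x * fps_eval g x)) => //.
  exact: fps_nnegM.
move=> N; apply: le_trans (ler_fps_seriesM _ f0 g0 x0) _.
by rewrite ler_pM ?fps_series_ge0 ?fps_series_le_eval.
Qed.

Lemma fps_nneg_evalM f g x : fps_nneg f -> fps_nneg g -> 0 <= x ->
  fps_cvg f x -> fps_cvg g x -> fps_eval (f * g) x = fps_eval f x * fps_eval g x.
Proof.
move=> f0 g0 x0 fx gx; have fgx := fps_nneg_cvgM f0 g0 x0 fx gx.
have fgN : (fun N => fps_series f x N * fps_series g x N) @ \oo -->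
    fps_eval f x * fps_eval g x by exact: cvgM.
apply/eqP; rewrite eq_le; apply/andP; split.
  by apply: ler_cvg_to fgx fgN _; apply: nearW => N; exact: ler_fps_seriesM.
apply: cvgr_to_le fgN _; apply: nearW => N.
apply: le_trans (ler_fps_series_doubleM _ f0 g0 x0) _.
by apply: fps_series_le_eval => //; exact: fps_nnegM.
Qed.

Lemma expr_convex x y t n : 0 <= x -> 0 <= y -> 0 <= t <= 1 ->
  (t * x + (1 - t) * y) ^+ n <= t * x ^+ n + (1 - t) * y ^+ n.
Proof.
move=> x0 y0 /andP[t0 t1]; case: n => [|n]; first by rewrite !expr0 !mulr1 addrC subrK.
have := @convex_powR R n.+1%:R _ (Itv01 t0 t1) x y.
rewrite ler1n !inE /= !in_itv /= !andbT => /(_ isT x0 y0); rewrite !convRE /= /unstable.onem.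
by rewrite !powR_mulrn // addr_ge0 ?mulr_ge0 ?subr_ge0.
Qed.

Lemma fps_eval_convex f x y t : fps_nneg f -> 0 <= x -> 0 <= y -> 0 <= t <= 1 ->
  fps_cvg f x -> fps_cvg f y -> fps_cvg f (t * x + (1 - t) * y) ->
  fps_eval f (t * x + (1 - t) * y) <= t * fps_eval f x + (1 - t) * fps_eval f y.
Proof.
move=> f0 x0 y0 t01 fx fy fxy; have /andP[t0 t1] := t01.
apply: fps_eval_le => // N.
apply: le_trans (_ : t * fps_series f x N + (1 - t) * fps_series f y N <= _).
  rewrite !fps_seriesE !mulr_sumr -big_split; apply: ler_sum => k _ /=.
  by rewrite !(mulrCA _ (f k)) -mulrDr ler_wpM2l // expr_convex.
by rewrite lerD // ler_wpM2l ?subr_ge0 ?fps_series_le_eval.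
Qed.

(* Convexity turns a gap between 0 and y into one between x and y. *)
Lemma fps_eval_lt f x y n : fps_nneg f -> 0 <= x -> x < y -> fps_cvg f y ->
  (0 < n)%N -> f n != 0 -> fps_eval f x < fps_eval f y.
Proof.
move=> f0 x0 xy fy n0 fn; have y0 : 0 < y by exact: le_lt_trans xy.
have gap : f 0%N < fps_eval f y.
  apply: lt_le_trans (fps_series_le_eval n.+1 f0 (ltW y0) fy).
  rewrite fps_seriesS; apply: ltr_pwDr.
    by rewrite mulr_gt0 ?exprn_gt0 // lt_def fn f0.
  have := fps_series_nondecreasing f0 (ltW y0) n0.
  by rewrite fps_seriesSl big_ord0 addr0.
have yx : 0 <= x / y <= 1 by rewrite divr_ge0 ?(ltW y0) //= ler_pdivrMr // mul1r ltW.
have xE : x / y * y + (1 - x / y) * 0 = x by rewrite mulr0 addr0 divfK ?gt_eqF.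
have := fps_eval_convex f0 (ltW y0) (lexx 0) yx fy (@fps_cvg0 _ f).
rewrite xE fps_eval0 => /(_ (fps_nneg_cvg_le f0 (fun=> lexx _) x0 (ltW xy) fy)).
move/le_lt_trans; apply; rewrite -subr_gt0.
have -> : fps_eval f y - (x / y * fps_eval f y + (1 - x / y) * f 0%N) =
  (1 - x / y) * (fps_eval f y - f 0%N) by ring.
by rewrite mulr_gt0 // subr_gt0 // ltr_pdivrMr // mul1r.
Qed.

Lemma fps_series_continuous f N : continuous (fps_series f ^~ N).
Proof.
under eq_fun do rewrite fps_seriesE.
apply: (@continuous_big _ _ +%R) => [|k _]; first exact: add_continuous.
move=> x; apply: cvgM; [exact: cvg_cst|exact: exprn_continuous].
Qed.

Lemma fps_eval_abel f x : fps_nneg f -> 0 <= x -> fps_cvg f x ->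
  fps_eval f (t * x) @[t --> 1^'-] --> fps_eval f x.
Proof.
move=> f0 x0 fx; apply/cvgrPdist_lt => e e0; have e2 : 0 < e / 2 by rewrite divr_gt0.
have [N _ /(_ N (leqnn N)) /= fN] : \forall N \near \oo,
    fps_eval f x - fps_series f x N < e / 2.
  move/cvgrPdist_lt: (fx : fps_series f x @ \oo --> fps_eval f x) => /(_ _ e2).
  by apply: filterS => N /ltr_normlW.
have cvgN : fps_series f (t * x) N @[t --> 1^'-] --> fps_series f x N.
  have cvg_tx : t * x @[t --> 1^'-] --> x.
    apply: cvg_at_left_filter; rewrite -[X in _ --> X]mul1r.
    by apply: cvgM; [exact: cvg_id|exact: cvg_cst].
  exact: (cvg_comp _ _ cvg_tx (@fps_series_continuous f N x)).
move/cvgrPdist_lt: cvgN => /(_ _ e2) cvgN.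
near=> t; have t0 : 0 <= t by near: t; exact: nbhs_left_ge.
have tx : t * x <= x by rewrite ler_piMl //; near: t; exact: nbhs_left_le.
have tx0 : 0 <= t * x by rewrite mulr_ge0.
have ftx : fps_cvg f (t * x) by exact: fps_nneg_cvg_le fx.
rewrite ger0_norm ?subr_ge0 ?ler_fps_eval //.
have := fps_series_le_eval N f0 tx0 ftx.
have /ltr_normlW : `|fps_series f x N - fps_series f (t * x) N| < e / 2 by near: t.
lra.
Unshelve. all: by end_near. Qed.

Lemma fps_nderivn_nneg f k : fps_nneg f -> fps_nneg (fps_nderivn f k).
Proof. by move=> f0 n /=; exact: mulrn_wge0. Qed.

Lemma fps_taylor_series_le f x y k N : fps_nneg f -> 0 <= x -> 0 <= y ->
  \sum_(i < k) y ^+ i * fps_series (fps_nderivn f i) x N <= fps_series f (x + y) (k + N)%N.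
Proof.
move=> f0 x0 y0; rewrite fps_series_taylor big_split_ord /=; apply: ler_wpDr.
  by apply: sumr_ge0 => i _; rewrite mulr_ge0 ?exprn_ge0 ?fps_series_ge0 //;
    exact: fps_nderivn_nneg.
apply: ler_sum => i _; rewrite ler_wpM2l ?exprn_ge0 //.
apply: fps_series_nondecreasing => //; first exact: fps_nderivn_nneg.
by rewrite addnC -addnBA ?leq_addr // ltnW.
Qed.

Lemma fps_cvg_nderivn f x y k : fps_nneg f -> 0 <= x -> x < y -> fps_cvg f y ->
  fps_cvg (fps_nderivn f k) x.
Proof.
move=> f0 x0 xy fy; have yx0 : 0 < y - x by rewrite subr_gt0.
apply: (fps_series_bounded_cvg (b := fps_eval f y / (y - x) ^+ k)) => // [|N].
  exact: fps_nderivn_nneg.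
rewrite ler_pdivlMr ?exprn_gt0 // mulrC.
have y0 : 0 <= y by rewrite (le_trans x0) // ltW.
apply: le_trans (fps_series_le_eval (k.+1 + N)%N f0 y0 fy).
rewrite -{2}(subrKC x y) (le_trans _ (fps_taylor_series_le _ _ _ _ _)) ?(ltW yx0) //.
rewrite big_ord_recr /= lerDr sumr_ge0 // => i _.
by rewrite mulr_ge0 ?exprn_ge0 ?fps_series_ge0 ?(ltW yx0) //; exact: fps_nderivn_nneg.
Qed.

Lemma fps_taylor_eval_le f x y k : fps_nneg f -> 0 <= x -> 0 <= y ->
  fps_cvg f (x + y) -> (forall i, fps_cvg (fps_nderivn f i) x) ->
  \sum_(i < k) y ^+ i * fps_eval (fps_nderivn f i) x <= fps_eval f (x + y).
Proof.
move=> f0 x0 y0 fxy fx.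
have cvg_sum : (fun N => \sum_(i < k) y ^+ i * fps_series (fps_nderivn f i) x N) @ \oo -->
    \sum_(i < k) y ^+ i * fps_eval (fps_nderivn f i) x.
  apply: (@cvg_big _ _ +%R) => [|i _]; first exact: add_continuous.
  by apply: cvgM; [exact: cvg_cst|exact: fx].
apply: cvgr_to_le cvg_sum _; apply: nearW => N.
apply: le_trans (fps_taylor_series_le _ _ f0 x0 y0) _.
by apply: fps_series_le_eval => //; exact: addr_ge0.
Qed.

End NonnegativeSeries.

Section NonnegativeMatrixEvaluation.
Variables (R : realType) (p q : nat) (M : 'M[fps R]_(p, q)).
Hypothesis M_nneg : mx_nneg M.
Implicit Types x y : R.

Lemma mx_nneg_cvg_le x y : 0 <= x -> x <= y -> mx_cvg M y -> mx_cvg M x.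
Proof. by move=> x0 xy My i j; apply: fps_nneg_cvg_le (My i j). Qed.

Lemma mx_eval_ge0 x : 0 <= x -> mx_cvg M x -> forall i j, 0 <= mx_eval M x i j.
Proof. by move=> x0 Mx i j; rewrite mxE fps_eval_ge0. Qed.

Lemma ler_mx_eval x y : 0 <= x -> x <= y -> mx_cvg M y ->
  forall i j, mx_eval M x i j <= mx_eval M y i j.
Proof. by move=> x0 xy My i j; rewrite !mxE; exact: ler_fps_eval. Qed.

Lemma mx_nneg_cvgM r (L : 'M[fps R]_(q, r)) x : 0 <= x -> mx_nneg L ->
  mx_cvg M x -> mx_cvg L x -> mx_cvg (M *m L) x.
Proof.
move=> x0 L_nneg Mx Lx i j; rewrite mxE; apply: fps_cvg_sum => k _.
exact: (fps_nneg_cvgM (M_nneg i k) (L_nneg k j) x0 (Mx i k) (Lx k j)).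
Qed.

Lemma mx_nneg_evalM r (L : 'M[fps R]_(q, r)) x : 0 <= x -> mx_nneg L ->
  mx_cvg M x -> mx_cvg L x -> mx_eval (M *m L) x = mx_eval M x *m mx_eval L x.
Proof.
move=> x0 L_nneg Mx Lx; apply/matrixP => i j; rewrite !mxE fps_eval_sum => [|k _].
  by apply: eq_bigr => k _; rewrite !mxE fps_nneg_evalM.
exact: (fps_nneg_cvgM (M_nneg i k) (L_nneg k j) x0 (Mx i k) (Lx k j)).
Qed.

End NonnegativeMatrixEvaluation.

Section AbsoluteConvergence.
Variable R : realType.
Local Notation C := R[i].
Local Notation K := (R[i] : numFieldType).
Local Open Scope complex_scope.
Implicit Types (f g : fps C) (x y t : R) (z w : C).

Definition fps_abs f : fps R := Fps (fun n => normc (f n)).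

Lemma fps_abs_nneg f : fps_nneg (fps_abs f).
Proof. by move=> n; exact: normc_ge0. Qed.

Lemma normc_fps_series_dist f z N M : (N <= M)%N ->
  normc (fps_series f z M - fps_series f z N) <=
  fps_series (fps_abs f) (normc z) M - fps_series (fps_abs f) (normc z) N.
Proof.
elim: M => [|M IH]; first by rewrite leqn0 => /eqP->; rewrite !subrr normc0.
rewrite leq_eqVlt => /predU1P[->|NM]; first by rewrite !subrr normc0.
rewrite !fps_seriesS !(addrAC _ _ (- _)) (le_trans (le_normcD _ _)) //.
by rewrite lerD ?IH // normcM normcX.
Qed.

Lemma normc_fps_series f z N :
  normc (fps_series f z N) <= fps_series (fps_abs f) (normc z) N.
Proof.
have := normc_fps_series_dist f z (leq0n N).
by rewrite ![fps_series _ _ 0%N]fps_seriesE !big_ord0 !subr0.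
Qed.

Lemma fps_abs_cvg_fps_cvg f z : fps_cvg (fps_abs f) (normc z) -> fps_cvg f z.
Proof.
move=> fz.
have dominated_cvg (h : {additive Rcomplex R -> R}) :
    (forall w, `|h w| <= normc w) -> cvgn (h \o fps_series f z).
  move=> h_le; have -> : h \o fps_series f z = series (fun n => h (f n * z ^+ n)).
    by apply/funext => n; rewrite /= /fps_series /series raddf_sum.
  apply: normed_cvg; apply: series_le_cvg fz => n /=.
  - exact: normr_ge0.
  - by rewrite mulr_ge0 ?exprn_ge0 ?normc_ge0.
  - by rewrite -normcX -normcM; exact: h_le.
have /cvg_ex[/= a fa] := dominated_cvg (@complex.Re R) (@normc_Re R).
have /cvg_ex[/= b fb] := dominated_cvg (@complex.Im R) (@normc_Im R).
by apply: (cvgP (a +i* b : K)); exact: cvg_Re_Im.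
Qed.

Lemma normc_fps_eval_tail f z N : fps_cvg (fps_abs f) (normc z) ->
  normc (fps_eval f z - fps_series f z N) <=
  fps_eval (fps_abs f) (normc z) - fps_series (fps_abs f) (normc z) N.
Proof.
move=> fz; have cvg_f : fps_series f z @ \oo --> (fps_eval f z : K).
  exact: fps_abs_cvg_fps_cvg.
have cvg_tail : normc (fps_series f z n - fps_series f z N) @[n --> \oo] -->
    normc (fps_eval f z - fps_series f z N).
  by apply: cvg_normc; exact: (cvgB cvg_f (cvg_cst _)).
apply: cvgr_to_le cvg_tail _; exists N => // n Nn.
rewrite (le_trans (normc_fps_series_dist f z Nn)) // lerD2r.
by rewrite fps_series_le_eval ?normc_ge0 //; exact: fps_abs_nneg.
Qed.

Lemma normc_fps_eval f z : fps_cvg (fps_abs f) (normc z) ->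
  normc (fps_eval f z) <= fps_eval (fps_abs f) (normc z).
Proof.
move/(normc_fps_eval_tail 0); by rewrite !fps_seriesE !big_ord0 !subr0.
Qed.

Lemma fps_abs_cvg_le f x y : 0 <= x -> x <= y ->
  fps_cvg (fps_abs f) y -> fps_cvg (fps_abs f) x.
Proof. by apply: fps_nneg_cvg_le => //; exact: fps_abs_nneg. Qed.

Lemma fps_cvg_abs_cvg f z x : 0 <= x -> x < normc z -> fps_cvg f z ->
  fps_cvg (fps_abs f) x.
Proof.
move=> x0 xz /cvg_series_cvg_0 /cvg_normc f0.
have /cvg_seq_bounded[b [_ fb]] := cvgP _ f0.
apply: (fps_cvg_geometric (fps_abs_nneg f) x0 xz (b := b + 1)) => n.
have := fb (b + 1) _ n I; rewrite ltrDl ltr01 => /(_ isT) /=.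
by rewrite normcM normcX; apply: le_trans; exact: ler_norm.
Qed.

Lemma fps_abs_cvgC c x : fps_cvg (fps_abs (fpsC c)) x.
Proof.
suff -> : fps_abs (fpsC c) = fpsC (normc c) by exact: fps_cvgC.
by apply: fpsP => -[|n] //; exact: normc0.
Qed.

Lemma ler_fps_absD f g n : fps_abs (f + g) n <= (fps_abs f + fps_abs g) n.
Proof. exact: le_normcD. Qed.

Lemma ler_fps_absM f g n : fps_abs (f * g) n <= (fps_abs f * fps_abs g) n.
Proof.
rewrite /= (le_trans (normc_sum _ _ _)) //.
by apply: ler_sum => i _; rewrite normcM.
Qed.

Lemma fps_abs_cvgD f g x : 0 <= x -> fps_cvg (fps_abs f) x ->
  fps_cvg (fps_abs g) x -> fps_cvg (fps_abs (f + g)) x.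
Proof.
move=> x0 fx gx; apply: (fps_nneg_cvg_le _ (ler_fps_absD f g) x0 (lexx x)).
  exact: fps_abs_nneg.
exact: fps_cvgD.
Qed.

Lemma fps_abs_cvgN f x : fps_cvg (fps_abs f) x -> fps_cvg (fps_abs (- f)) x.
Proof.
suff -> : fps_abs (- f) = fps_abs f by [].
by apply: fpsP => n /=; rewrite normcN.
Qed.

Lemma fps_abs_cvgM f g x : 0 <= x -> fps_cvg (fps_abs f) x ->
  fps_cvg (fps_abs g) x -> fps_cvg (fps_abs (f * g)) x.
Proof.
move=> x0 fx gx; apply: (fps_nneg_cvg_le _ (ler_fps_absM f g) x0 (lexx x)).
  exact: fps_abs_nneg.
by apply: fps_nneg_cvgM => //; exact: fps_abs_nneg.
Qed.

Lemma fps_abs_cvg_sum (I : Type) (r : seq I) (P : pred I) (F : I -> fps C) x :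
  0 <= x -> (forall i, P i -> fps_cvg (fps_abs (F i)) x) ->
  fps_cvg (fps_abs (\sum_(i <- r | P i) F i)) x.
Proof.
move=> x0 Fx; elim/big_ind: _ => //; first by rewrite -(raddf0 (@fpsC _)); exact: fps_abs_cvgC.
by move=> f g; exact: fps_abs_cvgD.
Qed.

(* The products of terms missed by the N-th partial sum of the Cauchy product
   are bounded by the same remainder for the series of moduli. *)
Lemma normc_fps_seriesM f g z N :
  normc (fps_series f z N * fps_series g z N - fps_series (f * g) z N) <=
  fps_series (fps_abs f) (normc z) N * fps_series (fps_abs g) (normc z) N -
  fps_series (fps_abs f * fps_abs g) (normc z) N.
Proof.
have remE (L : numFieldType) (a b : fps L) u :
    fps_series a u N * fps_series b u N - fps_series (a * b) u N =
    \sum_(i < N) a i * u ^+ i * (fps_series b u N - fps_series b u (N - i)%N).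
  rewrite fps_seriesM (fps_seriesE a) mulr_suml -sumrB.
  by apply: eq_bigr => i _; rewrite -mulrBr.
rewrite !remE (le_trans (normc_sum _ _ _)) //; apply: ler_sum => i _.
rewrite !normcM normcX ler_wpM2l ?mulr_ge0 ?exprn_ge0 ?normc_ge0 //.
by apply: normc_fps_series_dist; exact: leq_subr.
Qed.

Lemma fps_evalM f g z : fps_cvg (fps_abs f) (normc z) ->
  fps_cvg (fps_abs g) (normc z) ->
  fps_eval (f * g) z = fps_eval f z * fps_eval g z.
Proof.
move=> fz gz; set F := fps_abs f in fz *; set G := fps_abs g in gz *.
have F0 : fps_nneg F by exact: fps_abs_nneg.
have G0 : fps_nneg G by exact: fps_abs_nneg.
have rem0 : (fun N => fps_series F (normc z) N * fps_series G (normc z) N -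
    fps_series (F * G) (normc z) N) @ \oo --> 0.
  rewrite -(subrr (fps_eval F (normc z) * fps_eval G (normc z))).
  rewrite -{2}fps_nneg_evalM ?normc_ge0 //.
  apply: cvgB; [exact: cvgM|apply: fps_nneg_cvgM => //; exact: normc_ge0].
apply: fps_eval_eq; apply: cvgc_dist_squeeze _ _ rem0.
  by apply: cvgM; exact: fps_abs_cvg_fps_cvg.
by apply: nearW => N; rewrite normc_distC; exact: normc_fps_seriesM.
Qed.

Lemma normc_fps_eval_scale f z t : fps_cvg (fps_abs f) (normc z) -> 0 <= t <= 1 ->
  normc (fps_eval f z - fps_eval f (t%:C * z)) <=
  fps_eval (fps_abs f) (normc z) - fps_eval (fps_abs f) (t * normc z).
Proof.
move=> fz /andP[t0 t1]; have z0 := normc_ge0 z.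
have ntz : normc (t%:C * z) = t * normc z by rewrite normcM normc_real ger0_norm.
have ftz : fps_cvg (fps_abs f) (t * normc z).
  by apply: fps_abs_cvg_le fz; [exact: mulr_ge0|exact: ler_piMl].
have cvg_fz : fps_series f z @ \oo --> (fps_eval f z : K).
  exact: fps_abs_cvg_fps_cvg.
have cvg_ftz : fps_series f (t%:C * z) @ \oo --> (fps_eval f (t%:C * z) : K).
  by apply: fps_abs_cvg_fps_cvg; rewrite ntz.
have cvg_dist : normc (fps_series f z N - fps_series f (t%:C * z) N) @[N --> \oo] -->
    normc (fps_eval f z - fps_eval f (t%:C * z)).
  by apply: cvg_normc; exact: (cvgB cvg_fz cvg_ftz).
apply: ler_cvg_to cvg_dist (cvgB fz ftz) _; apply: nearW => N.
rewrite -[leRHS]/(fps_series _ _ N - fps_series _ _ N) !fps_seriesE -!sumrB.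
apply: le_trans (normc_sum _ _ _) _.
apply: ler_sum => k _; rewrite -!mulrBr normcM ler_wpM2l ?normc_ge0 //.
rewrite !exprMn -{1}[z ^+ k]mul1r -mulrBl normcM normcX -{2}[normc z ^+ k]mul1r -mulrBl.
rewrite ler_wpM2r ?exprn_ge0 // -rmorphXn -(rmorph1 (real_complex R)) -rmorphB.
by rewrite normc_real ger0_norm // subr_ge0 exprn_ile1.
Qed.

Lemma fpsc_eval_abel f z : fps_cvg (fps_abs f) (normc z) ->
  (fps_eval f (t%:C * z) : K) @[t --> 1^'-] -->
  (fps_eval f z : K).
Proof.
move=> fz.
have := fps_eval_abel (fps_abs_nneg f) (normc_ge0 z) fz.
rewrite -subr_cvg0 => /cvgN; rewrite oppr0 => abel.
apply: cvgc_squeeze _ abel; near=> t.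
rewrite normc_distC /= opprB; apply: normc_fps_eval_scale => //.
by apply/andP; split; near: t; [exact: nbhs_left_ge|exact: nbhs_left_le].
Unshelve. all: by end_near. Qed.

Lemma fps_eval_cvg0 (T : Type) (F : set_system T) {FF : Filter F}
    (u : T -> K) f x : 0 < x -> fps_cvg (fps_abs f) x ->
  u @ F --> (0 : K) ->
  (fps_eval f (u s) : K) @[s --> F] --> (f 0%N : K).
Proof.
move=> x0 fx /cvg_normc_distP; under eq_fun do rewrite subr0; move=> u0.
pose G := fps_abs f; have G0 : fps_nneg G by exact: fps_abs_nneg.
apply: (@cvgc_squeeze _ _ _ _ _ _ (fun s => normc (u s) / x * (fps_eval G x - G 0%N))).
  move/cvgrPdist_lt: u0 => /(_ x x0); apply: filterS => s.
  rewrite sub0r normrN ger0_norm ?normc_ge0 // => /ltW ux.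
  have us01 : 0 <= normc (u s) / x <= 1.
    by rewrite divr_ge0 ?normc_ge0 ?(ltW x0) //= ler_pdivrMr // mul1r.
  have usE : normc (u s) / x * x + (1 - normc (u s) / x) * 0 = normc (u s).
    by rewrite mulr0 addr0 divfK ?gt_eqF.
  have fus : fps_cvg G (normc (u s)) by apply: fps_abs_cvg_le fx => //; exact: normc_ge0.
  have := fps_eval_convex G0 (ltW x0) (lexx 0) us01 fx (@fps_cvg0 _ G).
  rewrite usE fps_eval0 => /(_ fus) convexG.
  have := normc_fps_eval_tail 1 fus.
  rewrite ![fps_series _ _ 1%N]fps_seriesSl !big_ord0 !addr0 => /le_trans; apply.
  by rewrite lerBlDr (le_trans convexG) // le_eqVlt; apply/orP; left; apply/eqP; ring.
have := cvgM (cvgM u0 (cvg_cst x^-1)) (cvg_cst (fps_eval G x - G 0%N)).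
by rewrite !mul0r; apply.
Qed.

Lemma fps_abs_nderivn f k : fps_abs (fps_nderivn f k) = fps_nderivn (fps_abs f) k.
Proof. by apply: fpsP => n /=; exact: normcMn. Qed.

Definition fps_recenter f z : fps C := Fps (fun k => fps_eval (fps_nderivn f k) z).

Lemma ler_fps_recenter f z y w N : normc z < y -> fps_cvg (fps_abs f) y ->
    normc z + normc w <= y ->
  \sum_(k < N) normc w ^+ k * fps_eval (fps_nderivn (fps_abs f) k) (normc z) <=
  fps_eval (fps_abs f) (normc z + normc w).
Proof.
move=> zy fy zw; apply: fps_taylor_eval_le; rewrite ?normc_ge0 //.
- exact: fps_abs_nneg.
- by apply: fps_abs_cvg_le fy; rewrite ?addr_ge0 ?normc_ge0.
- by move=> k; apply: fps_cvg_nderivn zy fy; [exact: fps_abs_nneg|exact: normc_ge0].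
Qed.

Lemma fps_recenter_abs_cvg f z y w : normc z < y -> fps_cvg (fps_abs f) y ->
  normc z + normc w <= y -> fps_cvg (fps_abs (fps_recenter f z)) (normc w).
Proof.
move=> zy fy zw; apply: (fps_series_bounded_cvg (fps_abs_nneg _) (normc_ge0 w)) => N.
apply: le_trans (ler_fps_recenter N zy fy zw); rewrite fps_seriesE.
apply: ler_sum => k _; rewrite mulrC ler_wpM2l ?exprn_ge0 ?normc_ge0 //= -fps_abs_nderivn.
apply: normc_fps_eval; rewrite fps_abs_nderivn.
by apply: fps_cvg_nderivn zy fy; [exact: fps_abs_nneg|exact: normc_ge0].
Qed.

Lemma fps_eval_recenter f z y w : normc z < y -> fps_cvg (fps_abs f) y ->
  normc z + normc w <= y -> fps_eval (fps_recenter f z) w = fps_eval f (z + w).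
Proof.
move=> zy fy zw; have [z0 w0] := (normc_ge0 z, normc_ge0 w).
have fzw : fps_cvg (fps_abs f) (normc z + normc w).
  by apply: fps_abs_cvg_le fy => //; exact: addr_ge0.
have tail0 : (fun N => fps_eval (fps_abs f) (normc z + normc w) -
    fps_series (fps_abs f) (normc z + normc w) N) @ \oo --> 0.
  by rewrite -(subrr (fps_eval (fps_abs f) (normc z + normc w))); apply: cvgB => //; exact: cvg_cst.
apply: fps_eval_eq; apply: cvgc_dist_squeeze _ _ tail0.
  apply: fps_abs_cvg_fps_cvg; apply: fps_abs_cvg_le fzw; [exact: normc_ge0|exact: le_normcD].
apply: nearW => N; rewrite normc_distC.
apply: le_trans (lerB (ler_fps_recenter N zy fy zw) (lexx _)).
rewrite !fps_series_taylor [X in normc (_ - X)]fps_seriesE -!sumrB.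
rewrite (le_trans (normc_sum _ _ _)) //; apply: ler_sum => k _.
rewrite [fps_recenter f z _ * _]mulrC -!mulrBr normcM normcX ler_wpM2l ?exprn_ge0 //.
rewrite normc_distC -fps_abs_nderivn; apply: normc_fps_eval_tail; rewrite fps_abs_nderivn.
by apply: fps_cvg_nderivn zy fy => //; exact: fps_abs_nneg.
Qed.

End AbsoluteConvergence.

(** * Matrices of power series *)

Section MatrixAbsoluteConvergence.
Variable R : realType.
Local Notation C := R[i].

Definition mx_abs p q (M : 'M[fps C]_(p, q)) : 'M[fps R]_(p, q) :=
  map_mx (@fps_abs R) M.

Section Linear.
Variables p q : nat.
Implicit Types (M : 'M[fps C]_(p, q)) (x : R) (z : C).

Lemma mx_abs_cvgP M x :
  mx_cvg (mx_abs M) x <-> forall i j, fps_cvg (fps_abs (M i j)) x.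
Proof. by split=> Mx i j; have := Mx i j; rewrite mxE. Qed.

Lemma mx_abs_nneg M : mx_nneg (mx_abs M).
Proof. by move=> i j; rewrite mxE; exact: fps_abs_nneg. Qed.

Lemma mx_eval_absE M x i j : mx_eval (mx_abs M) x i j = fps_eval (fps_abs (M i j)) x.
Proof. by rewrite !mxE. Qed.

Lemma mx_abs_cvg_le M x y : 0 <= x -> x <= y ->
  mx_cvg (mx_abs M) y -> mx_cvg (mx_abs M) x.
Proof. exact: (mx_nneg_cvg_le (mx_abs_nneg M)). Qed.

Lemma mx_abs_cvg_mx_cvg M z : mx_cvg (mx_abs M) (normc z) -> mx_cvg M z.
Proof. by move/mx_abs_cvgP => Mz i j; exact: fps_abs_cvg_fps_cvg. Qed.

Lemma mx_abs_cvgC (c : 'M[C]_(p, q)) x : mx_cvg (mx_abs (map_mx (@fpsC C) c)) x.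
Proof. by apply/mx_abs_cvgP => i j; rewrite mxE; exact: fps_abs_cvgC. Qed.

End Linear.

Section Product.
Variables p q r : nat.
Implicit Types (M : 'M[fps C]_(p, q)) (L : 'M[fps C]_(q, r)) (x : R) (z : C).

Lemma mx_abs_cvgM M L x : 0 <= x -> mx_cvg (mx_abs M) x -> mx_cvg (mx_abs L) x ->
  mx_cvg (mx_abs (M *m L)) x.
Proof.
move=> x0 /mx_abs_cvgP Mx /mx_abs_cvgP Lx; apply/mx_abs_cvgP => i j.
by rewrite mxE; apply: fps_abs_cvg_sum => // k _; exact: fps_abs_cvgM.
Qed.

Lemma mx_evalM M L z : mx_cvg (mx_abs M) (normc z) -> mx_cvg (mx_abs L) (normc z) ->
  mx_eval (M *m L) z = mx_eval M z *m mx_eval L z.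
Proof.
move=> /mx_abs_cvgP Mz /mx_abs_cvgP Lz; apply/matrixP => i j; rewrite !mxE fps_eval_sum.
  by apply: eq_bigr => k _; rewrite !mxE fps_evalM.
by move=> k _; apply: fps_abs_cvg_fps_cvg; apply: fps_abs_cvgM; rewrite ?normc_ge0.
Qed.

End Product.

End MatrixAbsoluteConvergence.

Section IdentityMinus.
Variables (R : realType) (m : nat).
Implicit Types (B : 'M[fps R[i]]_m) (x : R) (z : R[i]).

Lemma mx_abs_cvg_1B B x : 0 <= x -> mx_cvg (mx_abs B) x -> mx_cvg (mx_abs (1%:M - B)) x.
Proof.
move=> x0 /mx_abs_cvgP Bx; apply/mx_abs_cvgP => i j; rewrite !mxE -(rmorph_nat (@fpsC R[i])).
by apply: fps_abs_cvgD => //; [exact: fps_abs_cvgC|exact: fps_abs_cvgN].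
Qed.

Lemma mx_eval_1B B z : mx_cvg (mx_abs B) (normc z) ->
  mx_eval (1%:M - B) z = 1%:M - mx_eval B z.
Proof.
move=> /mx_abs_cvg_mx_cvg Bz; apply/matrixP => i j; rewrite !mxE -(rmorph_nat (@fpsC R[i])).
by rewrite fps_evalD ?fps_evalN ?fps_evalC //; [exact: fps_cvgC|exact: fps_cvgN].
Qed.

End IdentityMinus.

Section RadiusOfConvergence.
Variable R : realType.
Local Notation C := R[i].
Local Open Scope complex_scope.
Implicit Types (f g : fps C) (x y : R) (z : C).

Lemma lt_EFin_dense x (e : \bar R) : (x%:E < e)%E -> exists2 y, x < y & (y%:E < e)%E.
Proof.
case: e => [r|_|//]; last by exists (x + 1); rewrite ?ltrDl // ltry.
by rewrite lte_fin => /midf_lt[xm mr]; exists ((x + r) / 2).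
Qed.

Lemma abs_cvg_le_radius f x : 0 <= x -> fps_cvg (fps_abs f) x -> (x%:E <= fps_radius f)%E.
Proof.
move=> x0 fx; have normx : normc x%:C = x by rewrite normc_real ger0_norm.
apply: ereal_sup_ubound; exists x%:C; last by rewrite normx.
by apply: fps_abs_cvg_fps_cvg; rewrite normx.
Qed.

Lemma fps_radius_ge0 f : (0 <= fps_radius f)%E.
Proof. by apply: abs_cvg_le_radius => //; exact: fps_cvg0. Qed.

Lemma lt_radius_abs_cvg f x : 0 <= x -> (x%:E < fps_radius f)%E -> fps_cvg (fps_abs f) x.
Proof.
move=> x0 /ereal_sup_gt[_ [z fz <-]]; rewrite lte_fin => xz.
exact: fps_cvg_abs_cvg fz.
Qed.

Lemma le_fps_radius f (e : \bar R) :
  (forall x, 0 < x -> (x%:E < e)%E -> fps_cvg (fps_abs f) x) -> (e <= fps_radius f)%E.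
Proof.
move=> fe; rewrite leNgt; apply/negP; have := fps_radius_ge0 f.
case rE : (fps_radius f) => [r||//]; last by move=> _; rewrite ltNge leey.
rewrite lee_fin => r0 /lt_EFin_dense[y ry ye]; have y0 := le_lt_trans r0 ry.
by have := abs_cvg_le_radius (ltW y0) (fe y y0 ye); rewrite rE lee_fin leNgt ry.
Qed.

Lemma abs_cvg_radius_le f g :
  (forall x, 0 < x -> fps_cvg (fps_abs f) x -> fps_cvg (fps_abs g) x) ->
  (fps_radius f <= fps_radius g)%E.
Proof.
move=> fg; apply: le_fps_radius => x x0 xf; apply: fg => //.
by apply: lt_radius_abs_cvg xf; exact: ltW.
Qed.

Lemma mx_radius_le p q (M : 'M[fps C]_(p, q)) i j : (mx_radius M <= fps_radius (M i j))%E.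
Proof. exact: le_trans (bigmin_le _ i _) (bigmin_le _ j _). Qed.

Lemma le_mx_radius p q (M : 'M[fps C]_(p, q)) (e : \bar R) :
  (forall i j, (e <= fps_radius (M i j))%E) -> (e <= mx_radius M)%E.
Proof.
move=> eM; apply: le_bigmin => [|i _]; first exact: leey.
by apply: le_bigmin => [|j _]; [exact: leey|exact: eM].
Qed.

Lemma mx_abs_cvg_le_radius p q (M : 'M[fps C]_(p, q)) x : 0 <= x ->
  mx_cvg (mx_abs M) x -> (x%:E <= mx_radius M)%E.
Proof.
by move=> x0 /mx_abs_cvgP Mx; apply: le_mx_radius => i j; exact: abs_cvg_le_radius.
Qed.

Lemma lt_mx_radius_abs_cvg p q (M : 'M[fps C]_(p, q)) x : 0 <= x ->
  (x%:E < mx_radius M)%E -> mx_cvg (mx_abs M) x.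
Proof.
move=> x0 xM; apply/mx_abs_cvgP => i j; apply: lt_radius_abs_cvg => //.
exact: lt_le_trans (mx_radius_le _ _ _).
Qed.

End RadiusOfConvergence.

Section DominatedSolutions.
Variables (R : realType) (m : nat).
Local Notation C := R[i].

Lemma ler_mx_fps_series_solution p (A Y : 'M[fps C]_(m, p)) (B : 'M[fps C]_m) x N i j :
  0 <= x -> Y = A + B *m Y -> mx_cvg (mx_abs A) x -> mx_cvg (mx_abs B) x ->
  fps_series (fps_abs (Y i j)) x N <= mx_eval (mx_abs A) x i j +
    \sum_k mx_eval (mx_abs B) x i k * fps_series (fps_abs (Y k j)) x N.
Proof.
move=> x0 YE /mx_abs_cvgP Ax /mx_abs_cvgP Bx.
have series_le (f g : fps C) M : fps_series (fps_abs (f + g)) x M <=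
    fps_series (fps_abs f) x M + fps_series (fps_abs g) x M.
  have := ler_fps_series M (fps_abs_nneg _) (ler_fps_absD f g) x0 (lexx x).
  by rewrite fps_seriesD.
rewrite {1}YE !mxE (le_trans (series_le _ _ _)) // lerD //.
  by apply: fps_series_le_eval => //; exact: fps_abs_nneg.
elim/big_rec2: _ => [|k s f _ fs].
  by rewrite fps_seriesE big1 // => n _; rewrite [fps_abs _ _]normc0 mul0r.
rewrite (le_trans (series_le _ _ _)) // lerD // !mxE.
have nneg := @fps_abs_nneg R.
apply: le_trans (ler_fps_series N (nneg _) (ler_fps_absM _ _) x0 (lexx x)) _.
apply: le_trans (ler_fps_seriesM N (nneg _) (nneg _) x0) _.
by rewrite ler_wpM2r ?fps_series_ge0 // fps_series_le_eval.
Qed.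

(* Weighting the partial sums of Y by v turns the fixed point equation into the
   scalar inequality s <= a + l s. *)
Lemma solution_abs_cvg p (A Y : 'M[fps C]_(m, p)) (B : 'M[fps C]_m) (v : 'rV[R]_m) l x :
  0 <= x -> Y = A + B *m Y -> mx_cvg (mx_abs A) x -> mx_cvg (mx_abs B) x ->
  (forall i, 0 < v 0 i) -> l < 1 ->
  (forall j, (v *m mx_eval (mx_abs B) x) 0 j <= l * v 0 j) -> mx_cvg (mx_abs Y) x.
Proof.
move=> x0 YE Ax Bx v0 l1 vB; apply/mx_abs_cvgP => i j.
pose P N k := fps_series (fps_abs (Y k j)) x N.
have P0 N k : 0 <= P N k by apply: fps_series_ge0 => //; exact: fps_abs_nneg.
pose a := (v *m mx_eval (mx_abs A) x) 0 j.
have bound N : \sum_k v 0 k * P N k <= a / (1 - l).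
  rewrite ler_pdivlMr ?subr_gt0 // mulrBr mulr1 lerBlDr.
  apply: le_trans (ler_sum _ (fun k _ => ler_wpM2l (ltW (v0 k))
    (ler_mx_fps_series_solution N k j x0 YE Ax Bx))) _.
  under eq_bigr do rewrite mulrDr mulr_sumr; rewrite big_split /= lerD //.
    by rewrite /a mxE.
  rewrite exchange_big mulr_suml; apply: ler_sum => k _ /=.
  rewrite -mulrA [P N k * l]mulrC mulrA; have := vB k; rewrite mxE mulrC => vBk.
  apply: le_trans (ler_wpM2r (P0 N k) vBk); rewrite mulr_suml.
  by apply: ler_sum => h _; rewrite mulrA.
apply: (fps_series_bounded_cvg (b := a / (1 - l) / v 0 i)) => // [|N].
  exact: fps_abs_nneg.
rewrite ler_pdivlMr // mulrC; apply: le_trans (bound N).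
by rewrite (bigD1 i) //= lerDl sumr_ge0 // => k _; rewrite mulr_ge0 // ltW.
Qed.

Lemma fps_eval_scale_le (f : fps R) x t : fps_nneg f -> f 0%N = 0 -> 0 <= x ->
  0 <= t <= 1 -> fps_cvg f x -> fps_eval f (t * x) <= t * fps_eval f x.
Proof.
move=> f0 f00 x0 t01 fx; have := fps_eval_convex f0 x0 (lexx 0) t01 fx (@fps_cvg0 _ f).
rewrite mulr0 addr0 fps_eval0 f00 mulr0 addr0; apply.
case/andP: t01 => t0 t1.
by apply: fps_nneg_cvg_le fx => //; [exact: mulr_ge0|exact: ler_piMl].
Qed.

Lemma mx_eval_abs_small p q (H : 'M[fps C]_(p, q)) x e : 0 < x -> 0 < e ->
  mx_cvg (mx_abs H) x -> map_mx (@fps_coef0 C) H = 0 ->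
  exists2 y, 0 < y <= x & forall j, \sum_i mx_eval (mx_abs H) y i j <= e.
Proof.
move=> x0 e0 Hx /matrixP H0; pose S := \sum_i \sum_j mx_eval (mx_abs H) x i j.
have Hx0 := mx_eval_ge0 (mx_abs_nneg H) (ltW x0) Hx.
have S0 : 0 <= S by apply: sumr_ge0 => i _; exact: sumr_ge0.
have eS0 : 0 < e + S by rewrite ltr_pwDl.
have t0 : 0 < e / (e + S) by rewrite divr_gt0.
have t1 : e / (e + S) <= 1 by rewrite ler_pdivrMr // mul1r lerDl.
exists (e / (e + S) * x); first by rewrite mulr_gt0 //= ler_piMl // ltW.
move=> j; apply: (@le_trans _ _ (e / (e + S) * S)); last first.
  by rewrite mulrAC ler_pdivrMr // mulrDr lerDr mulr_ge0 // ltW.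
rewrite mulr_sumr; apply: ler_sum => i _.
rewrite (bigD1 j) //= mulrDr; apply: ler_wpDr.
  by rewrite mulr_ge0 ?sumr_ge0 // ltW.
rewrite !mx_eval_absE; apply: fps_eval_scale_le; rewrite ?(ltW t0) ?(ltW x0) //.
- exact: fps_abs_nneg.
- by have := H0 i j; rewrite !mxE /= /fps_coef0 => ->; exact: normc0.
- by move/mx_abs_cvgP: Hx.
Qed.

(* With M(0) = M0, the inverse solves F = M0^-1 + (1 - M0^-1 M) F. *)
Lemma unitmx_abs_cvg_inv (M : 'M[fps C]_m) x : 0 < x -> mx_cvg (mx_abs M) x ->
  map_mx (@fps_coef0 C) M \in unitmx ->
  M \in unitmx /\ exists2 y, 0 < y <= x & mx_cvg (mx_abs (invmx M)) y.
Proof.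
move=> x0 Mx uM0; set M0 := map_mx _ M in uM0.
pose c : 'M[fps C]_m := map_mx (@fpsC C) (invmx M0).
pose H := 1%:M - c *m M.
have H0 : map_mx (@fps_coef0 C) H = 0.
  rewrite map_mxB map_mx1 map_mxM -/M0 (_ : map_mx _ c = invmx M0) ?mulVmx ?subrr //.
  by apply/matrixP => i j; rewrite !mxE.
have ucM : c *m M \in unitmx.
  have -> : c *m M = 1%:M - H by rewrite subKr.
  by apply: unitmx_1B; exists 1%N; rewrite expr1.
have uM : M \in unitmx by move: ucM; rewrite unitmx_mul => /andP[].
have invE : invmx M = c + H *m invmx M.
  by rewrite /H mulmxBl mul1mx -mulmxA mulmxV // mulmx1 addrC subrK.
have Hx : mx_cvg (mx_abs H) x.
  apply: mx_abs_cvg_1B; first exact: ltW.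
  by apply: mx_abs_cvgM => //; [exact: ltW|exact: mx_abs_cvgC].
have half0 : 0 < 2^-1 :> R by rewrite invr_gt0.
have [y /andP[y0 yx] Hy] := mx_eval_abs_small x0 half0 Hx H0.
split=> //; exists y; first by rewrite y0.
apply: (@solution_abs_cvg _ c _ H (const_mx 1) (2^-1)) => //.
- exact: ltW.
- exact: mx_abs_cvgC.
- by apply: mx_abs_cvg_le Hx => //; exact: ltW.
- by move=> i; rewrite mxE.
- by rewrite invf_lt1 // ltr1n.
move=> j; rewrite mxE [const_mx _ _ _]mxE mulr1.
by under eq_bigr do rewrite [const_mx _ _ _]mxE mul1r.
Qed.

End DominatedSolutions.

(** * Analytic continuation of solutions *)

Section AnalyticContinuation.
Variable R : realType.
Local Notation C := R[i].
Local Notation K := (R[i] : numFieldType).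
Local Open Scope complex_scope.

Lemma regular_inside (f : fps C) z : ((normc z)%:E < fps_radius f)%E -> regular_at f z.
Proof.
move=> /lt_EFin_dense[y zy yf]; have y0 := le_lt_trans (normc_ge0 z) zy.
have fy := lt_radius_abs_cvg (ltW y0) yf.
exists (fps_recenter f z), (y - normc z); first by rewrite subr_gt0.
move=> w wz; have zwy : normc z + normc (w - z) <= y by rewrite -lerBrDl ltW.
split; first exact: fps_abs_cvg_fps_cvg (fps_recenter_abs_cvg zy fy zwy).
by rewrite (fps_eval_recenter zy fy zwy) subrKC.
Qed.

Lemma not_dominant_sing_regular p q (M : 'M[fps C]_(p, q)) z :
  ((normc z)%:E <= mx_radius M)%E -> ~ dominant_sing M z ->
  forall i j, regular_at (M i j) z.
Proof.
rewrite le_eqVlt => /predU1P[zM nsing i j|zM _ i j].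
  by apply: contrapT => nreg; apply: nsing; split=> //; exists i, j.
by apply: regular_inside; apply: lt_le_trans zM _; exact: mx_radius_le.
Qed.

Definition mx_continuation p q (M : 'M[fps C]_(p, q)) z (G : 'M[fps C]_(p, q)) r : Prop :=
  forall w : C, normc (w - z) < r -> mx_cvg G (w - z) /\
    (((normc w)%:E < mx_radius M)%E -> mx_eval M w = mx_eval G (w - z)).

Section Continuation.
Variables (p q : nat) (M G : 'M[fps C]_(p, q)) (z : C) (r : R).
Hypotheses (r0 : 0 < r) (MG : mx_continuation M z G r).

Lemma mx_continuation_le s : s <= r -> mx_continuation M z G s.
Proof. by move=> sr w wz; apply: MG; exact: lt_le_trans sr. Qed.

Lemma mx_continuation_abs_cvg x : 0 <= x -> x < r -> mx_cvg (mx_abs G) x.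
Proof.
move=> x0 /midf_lt[xm mr]; set y := (x + r) / 2 in xm mr.
have normy : normc y%:C = y by rewrite normc_real ger0_norm // (le_trans x0) // ltW.
have [|Gy _] := MG (w := z + y%:C); first by rewrite addrAC subrr add0r normy.
apply/mx_abs_cvgP => i j; apply: (@fps_cvg_abs_cvg _ _ y%:C) => //; first by rewrite normy.
by have := Gy i j; rewrite addrAC subrr add0r.
Qed.

Lemma mx_continuation_center : 0 < normc z -> ((normc z)%:E <= mx_radius M)%E ->
  mx_cvg (mx_abs M) (normc z) -> mx_eval M z = map_mx (@fps_coef0 C) G.
Proof.
move=> z0 zM Mz; apply/matrixP => i j; rewrite !mxE.
have r20 : 0 < r / 2 by rewrite divr_gt0.
have Gr : fps_cvg (fps_abs (G i j)) (r / 2).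
  have r2r : r / 2 < r by rewrite ltr_pdivrMr // ltr_pMr // ltr1n.
  by have /mx_abs_cvgP := mx_continuation_abs_cvg (ltW r20) r2r.
have dist_tz t : normc (t%:C * z - z) = `|1 - t| * normc z.
  rewrite -{2}[z]mul1r -mulrBl normcM normc_distC -(rmorph1 (real_complex R)) -rmorphB.
  by rewrite normc_real.
have dist0 : normc (t%:C * z - z) @[t --> 1^'-] --> (0 : R).
  have abs0 : `|1 - t| @[t --> (1 : R)] --> (0 : R).
    rewrite -(normr0 R) -(subrr 1); apply: cvg_norm.
    exact: (cvgB (cvg_cst _) cvg_id).
  under eq_fun do rewrite dist_tz; apply: cvg_at_left_filter.
  by have := cvgM abs0 (cvg_cst (normc z)); rewrite mul0r; apply.
have G0 : fps_eval (G i j) (t%:C * z - z) @[t --> 1^'-] --> (G i j 0%N : K).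
  apply: fps_eval_cvg0 r20 Gr _.
  by apply/cvg_normc_distP; under eq_fun do rewrite subr0.
have Mabel := fpsc_eval_abel ((mx_abs_cvgP M _).1 Mz i j).
apply: (cvg_unique _ Mabel); first exact: norm_hausdorff.
apply: cvg_trans G0; apply: near_eq_cvg; near=> t.
have [|_ MGt] := MG (w := t%:C * z).
  near: t; move/cvgrPdist_lt: dist0 => /(_ r r0); apply: filterS => t.
  by rewrite sub0r normrN ger0_norm ?normc_ge0.
have t0 : 0 <= t by near: t; exact: nbhs_left_ge.
have t1 : t < 1 by near: t; exact: nbhs_left_lt.
have /MGt/matrixP/(_ i j) : ((normc (t%:C * z))%:E < mx_radius M)%E.
  by apply: lt_le_trans zM; rewrite lte_fin normcM normc_real ger0_norm // gtr_pMl.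
rewrite !mxE => ->; exact: erefl.
Unshelve. all: by end_near. Qed.

End Continuation.

Lemma regular_mx_continuation p q (M : 'M[fps C]_(p, q)) z :
  (forall i j, regular_at (M i j) z) ->
  exists G, exists2 r, 0 < r & mx_continuation M z G r.
Proof.
move=> Mz; have /choice[G] : forall k : 'I_p * 'I_q, exists g : fps C, exists r : R, 0 < r /\
    forall w, normc (w - z) < r -> fps_cvg g (w - z) /\
    (((normc w)%:E < fps_radius (M k.1 k.2))%E ->
      fps_eval (M k.1 k.2) w = fps_eval g (w - z)).
  by move=> k; have [g [r r0 Mg]] := Mz k.1 k.2; exists g, r.
move=> /choice[r MG]; exists (\matrix_(i, j) G (i, j)), (\big[Num.min/1]_k r k).
  by apply: lt_bigmin => // k _; exact: (MG k).1.
move=> w wz; have {}MG i j := (MG (i, j)).2 w (lt_le_trans wz (bigmin_le _ _ _)).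
split=> [i j|wM]; first by rewrite mxE; exact: (MG i j).1.
apply/matrixP => i j; rewrite !mxE; apply: (MG i j).2.
exact: lt_le_trans (mx_radius_le _ _ _).
Qed.

End AnalyticContinuation.

Section RegularSolutions.
Variables (R : realType) (m p : nat).
Local Notation C := R[i].
Variables (A Y : 'M[fps C]_(m, p)) (B : 'M[fps C]_m) (z : C).
Hypotheses (YE : Y = A + B *m Y) (z0 : 0 < normc z).
Hypotheses (YA : (mx_radius Y <= mx_radius A)%E) (YB : (mx_radius Y <= mx_radius B)%E).
Hypothesis zY : ((normc z)%:E <= mx_radius Y)%E.
Hypotheses (Bz : mx_cvg (mx_abs B) (normc z)) (uBz : 1%:M - mx_eval B z \in unitmx).

Lemma solution_mx_continuation GA GB r : 0 < r ->
  mx_continuation A z GA r -> mx_continuation B z GB r ->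
  exists2 s, 0 < s & mx_continuation Y z (invmx (1%:M - GB) *m GA) s.
Proof.
move=> r0 AGA BGB.
have r20 : 0 < r / 2 by rewrite divr_gt0.
have r2r : r / 2 < r by rewrite ltr_pdivrMr // ltr_pMr // ltr1n.
have GBr := mx_continuation_abs_cvg BGB (ltW r20) r2r.
have GAr := mx_continuation_abs_cvg AGA (ltW r20) r2r.
have uG0 : map_mx (@fps_coef0 C) (1%:M - GB) \in unitmx.
  by rewrite map_mxB map_mx1 -(mx_continuation_center r0 BGB z0 (le_trans zY YB) Bz).
have [uG [s /andP[s0 sr] Fs]] :=
  unitmx_abs_cvg_inv r20 (mx_abs_cvg_1B (ltW r20) GBr) uG0.
set F := invmx (1%:M - GB) in Fs *.
exists s; first exact: s0.
move=> w wz; set t := w - z in wz *; have [t0 w0] := (normc_ge0 t, normc_ge0 w).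
have t_le := le_trans (ltW wz) sr; have t_lt := le_lt_trans t_le r2r.
have [GAt GBt] := (mx_abs_cvg_le t0 t_le GAr, mx_abs_cvg_le t0 t_le GBr).
have Ft := mx_abs_cvg_le t0 (ltW wz) Fs.
split=> [|wY]; first exact: mx_abs_cvg_mx_cvg (mx_abs_cvgM t0 Ft GAt).
have Yw := lt_mx_radius_abs_cvg w0 wY.
have Bw := lt_mx_radius_abs_cvg w0 (lt_le_trans wY YB).
have Aw := mx_abs_cvg_mx_cvg (lt_mx_radius_abs_cvg w0 (lt_le_trans wY YA)).
have BYw := mx_abs_cvg_mx_cvg (mx_abs_cvgM w0 Bw Yw).
have Aeval := (AGA w t_lt).2 (lt_le_trans wY YA).
have Beval := (BGB w t_lt).2 (lt_le_trans wY YB).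
have resolved : (1%:M - mx_eval GB t) *m mx_eval Y w = mx_eval GA t.
  rewrite -Aeval -Beval mulmxBl mul1mx -(mx_evalM Bw Yw) {1}YE (mx_evalD Aw BYw).
  exact: addrK.
have inverse : mx_eval F t *m (1%:M - mx_eval GB t) = 1%:M.
  rewrite -(mx_eval_1B GBt) -(mx_evalM Ft (mx_abs_cvg_1B t0 GBt)) (mulVmx uG).
  exact: mx_eval1.
by rewrite (mx_evalM Ft GAt) -resolved mulmxA inverse mul1mx.
Qed.

Lemma solution_regular : (forall i j, fps_radius (Y i j) = mx_radius Y) ->
  (forall i j, regular_at (A i j) z) -> (forall i j, regular_at (B i j) z) ->
  forall i j, regular_at (Y i j) z.
Proof.
move=> Yr /regular_mx_continuation[GA [ra ra0 AGA]] /regular_mx_continuation[GB [rb rb0 BGB]].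
have r0 : 0 < Num.min ra rb by rewrite lt_min ra0.
have ler_ra : Num.min ra rb <= ra by rewrite ge_min lexx.
have ler_rb : Num.min ra rb <= rb by rewrite ge_min lexx orbT.
have [s s0 YG] := solution_mx_continuation r0
  (mx_continuation_le AGA ler_ra) (mx_continuation_le BGB ler_rb).
move=> i j; exists ((invmx (1%:M - GB) *m GA) i j), s => // w wz.
have [Gw YGw] := YG w wz; split=> [|]; first exact: Gw.
by rewrite Yr => /YGw/matrixP/(_ i j); rewrite [LHS]mxE [RHS]mxE.
Qed.

End RegularSolutions.

(** * Perron-Frobenius theory *)

Definition mx_dependency (V : nmodType) m (M : 'M[V]_m) : rel 'I_m :=
  [rel i j | M i j != 0].

Section PerronFrobenius.
Variable R : realType.

Lemma ler_mulmx_row_col m (v w : 'rV[R]_m) (u : 'cV[R]_m) :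
  (forall j, v 0 j <= w 0 j) -> (forall i, 0 <= u i 0) ->
  (v *m u) 0 0 <= (w *m u) 0 0.
Proof. by move=> vw u0; rewrite !mxE; apply: ler_sum => j _; rewrite ler_wpM2r. Qed.

Lemma ltr_mulmx_row_col m (v w : 'rV[R]_m) (u : 'cV[R]_m) j :
  (forall j, v 0 j <= w 0 j) -> v 0 j < w 0 j -> (forall i, 0 < u i 0) ->
  (v *m u) 0 0 < (w *m u) 0 0.
Proof.
move=> vw vwj u0; rewrite !mxE (bigD1 j) //= [ltRHS](bigD1 j) //=.
rewrite ltr_leD ?ltr_pM2r //; apply: ler_sum => k _.
by rewrite ler_wpM2r // ltW.
Qed.

Lemma mulmx_row_col_gt0 m (v : 'rV[R]_m) (u : 'cV[R]_m) :
  (forall i, 0 <= v 0 i) -> v != 0 -> (forall i, 0 < u i 0) -> 0 < (v *m u) 0 0.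
Proof.
move=> v0 /rV0Pn[i vi] u0.
have := @ltr_mulmx_row_col m 0 v u i; rewrite mul0mx !mxE lt_def vi v0.
by apply=> // j; rewrite mxE.
Qed.

Lemma expmx_ge0 m (M : 'M[R]_m) n : (forall i j, 0 <= M i j) ->
  forall i j, 0 <= (M ^+ n) i j.
Proof.
move=> M0; elim: n => [|n IH] i j; first by rewrite mxE ler0n.
by rewrite exprS mxE sumr_ge0 // => k _; rewrite mulr_ge0.
Qed.

Variable m : nat.
Implicit Types (M N : 'M[R]_m) (v w : 'rV[R]_m) (u : 'cV[R]_m).

Definition irreducible_mx M : Prop :=
  (forall i j, 0 <= M i j) /\ (forall i j, connect (mx_dependency M) i j).

Lemma irreducible_mx_tr M : irreducible_mx M -> irreducible_mx M^T.
Proof.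
move=> [M0 Mc]; split=> [i j|i j]; first by rewrite mxE.
have -> : connect (mx_dependency M^T) i j = connect [rel k l | mx_dependency M l k] i j.
  by apply: eq_connect => k l; rewrite /mx_dependency /= mxE.
by rewrite connect_rev; exact: Mc.
Qed.

Lemma mulmx_row_ge0 M v : (forall i j, 0 <= M i j) -> (forall i, 0 <= v 0 i) ->
  forall j, 0 <= (v *m M) 0 j.
Proof. by move=> M0 v0 j; rewrite mxE sumr_ge0 // => i _; rewrite mulr_ge0. Qed.

Lemma subinvariant_gt0 M v a : irreducible_mx M -> (forall i, 0 <= v 0 i) -> v != 0 ->
  (forall j, (v *m M) 0 j <= a * v 0 j) -> forall i, 0 < v 0 i.
Proof.
move=> [M0 Mc] v0 /rV0Pn[k vk] vM i; rewrite lt_def v0 andbT; apply: contra vk.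
have /connectP[p] := Mc k i; elim: p k => [|j p IH] k /=; first by move=> _ ->.
case/andP=> Mkj pp lastp vi; have /eqP vj := IH _ pp lastp vi.
have : v 0 k * M k j <= 0.
  rewrite -(mulr0 a) -vj; apply: le_trans (vM j); rewrite mxE (bigD1 k) //= lerDl.
  by rewrite sumr_ge0 // => l _; rewrite mulr_ge0.
by rewrite le_eqVlt ltNge mulr_ge0 // orbF mulf_eq0 (negbTE Mkj) orbF.
Qed.

Section PowersOfOnePlus.
Variable M : 'M[R]_m.
Hypothesis Mirr : irreducible_mx M.
Local Notation P := (1%:M + M).

Lemma expmx_1D_ge0 n i j : 0 <= (P ^+ n) i j.
Proof.
by apply: expmx_ge0 => k l; rewrite !mxE addr_ge0 ?ler0n // Mirr.1.
Qed.

Lemma ler_mulmx_expmx_1D n i j k : M i k * (P ^+ n) k j <= (P ^+ n.+1) i j.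
Proof.
have [M0 _] := Mirr; have Pn0 := expmx_1D_ge0 n.
rewrite exprS -[P * _]/(P *m _) mulmxDl mul1mx mxE ler_wpDl //.
by rewrite mxE (bigD1 k) //= lerDl sumr_ge0 // => l _; rewrite mulr_ge0.
Qed.

Lemma ler_expmx_1D n k i j : (n <= k)%N -> (P ^+ n) i j <= (P ^+ k) i j.
Proof.
move=> /subnKC <-; elim: (k - n)%N => [|d IH]; first by rewrite addn0.
apply: le_trans IH _; rewrite addnS exprS -[P * _]/(P *m _) mulmxDl mul1mx.
rewrite [leRHS]mxE lerDl mxE sumr_ge0 // => l _.
by rewrite mulr_ge0 ?expmx_1D_ge0 // Mirr.1.
Qed.

Lemma expmx_1D_gt0 : exists n, forall i j, 0 < (P ^+ n) i j.
Proof.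
have entry_gt0 k : exists n, 0 < (P ^+ n) k.1 k.2.
  case: k => i j; have /connectP[p] := Mirr.2 i j; elim: p i => [|k p IH] i /=.
    by move=> _ ->; exists 0%N; rewrite expr0 mxE eqxx.
  case/andP=> Mik pp /(IH _ pp)[n Pn]; exists n.+1.
  by apply: lt_le_trans (ler_mulmx_expmx_1D n i j k); rewrite mulr_gt0 // lt_def Mirr.1 andbT.
have [n Pn] := choice entry_gt0; exists (\max_k n k)%N => i j.
by apply: lt_le_trans (Pn (i, j)) _; apply: ler_expmx_1D; exact: leq_bigmax.
Qed.

Lemma mulmx_expmx_1DC n : M *m P ^+ n = P ^+ n *m M.
Proof. by apply: commrX; rewrite /GRing.comm mulrDl mulrDr mul1r mulr1. Qed.

End PowersOfOnePlus.

Definition subeigen M l v : Prop :=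
  [/\ forall i, 0 <= v 0 i, v != 0 & forall j, l * v 0 j <= (v *m M) 0 j].

Lemma sumr_row_gt0 v : (forall i, 0 <= v 0 i) -> v != 0 -> 0 < \sum_i v 0 i.
Proof.
move=> v0 vn; have := @mulmx_row_col_gt0 m v (const_mx 1) v0 vn.
rewrite mxE; under eq_bigr do rewrite [const_mx _ _ _]mxE mulr1.
by apply=> i; rewrite mxE.
Qed.

Lemma subeigen_le_sum M l v : (forall i j, 0 <= M i j) -> subeigen M l v ->
  l <= \sum_i \sum_j M i j.
Proof.
move=> M0 [v0 vn lv]; have s0 := sumr_row_gt0 v0 vn.
rewrite -(ler_pM2r s0) mulr_sumr (le_trans (ler_sum _ (fun j _ => lv j))) //.
under eq_bigr do rewrite mxE; rewrite exchange_big mulr_suml; apply: ler_sum => i _ /=.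
rewrite mulr_suml; apply: ler_sum => j _; rewrite mulrC ler_wpM2l //.
by rewrite (bigD1 i) //= lerDl sumr_ge0.
Qed.

Lemma subeigen_scale M l v c : 0 < c -> subeigen M l v -> subeigen M l (c *: v).
Proof.
move=> c0 [v0 vn lv]; split=> [i||j]; first by rewrite mxE mulr_ge0 // ltW.
  by rewrite scaler_eq0 negb_or gt_eqF.
by rewrite -scalemxAl ![fun_of_matrix (c *: _) _ _]mxE mulrCA ler_pM2l.
Qed.

(* If the slack of a maximal subeigenvector were nonzero, a power of 1 + M would
   make it positive everywhere and the eigenvalue could be raised. *)
Lemma max_subeigen_eigen M l v : irreducible_mx M -> subeigen M l v ->
  (forall k w, subeigen M k w -> k <= l) -> v *m M = l *: v.
Proof.
move=> Mirr [v0 vn lv] lmax; have [n Pn] := expmx_1D_gt0 Mirr.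
apply/eqP; rewrite -subr_eq0; apply/negPn/negP => slack_neq0.
set P := (1%:M + M) ^+ n in Pn; pose V := v *m P.
have mulP_gt0 (w : 'rV[R]_m) : (forall i, 0 <= w 0 i) -> w != 0 ->
    forall j, 0 < (w *m P) 0 j.
  move=> w0 wn j; have -> : (w *m P) 0 j = (w *m col j P) 0 0.
    by rewrite !mxE; apply: eq_bigr => i _; rewrite mxE.
  by apply: mulmx_row_col_gt0 => // i; rewrite mxE.
have V0 j : 0 < V 0 j by exact: mulP_gt0.
have slackE : V *m M - l *: V = (v *m M - l *: v) *m P.
  by rewrite mulmxBl -scalemxAl -!mulmxA mulmx_expmx_1DC.
have slack_gt0 j : 0 < (V *m M - l *: V) 0 j.
  rewrite slackE; apply: mulP_gt0 => // i.
  by rewrite mxE [fun_of_matrix (- _) 0 i]mxE [fun_of_matrix (l *: v) 0 i]mxE subr_ge0.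
pose e := \big[Num.min/1]_j ((V *m M - l *: V) 0 j / V 0 j).
have e0 : 0 < e by apply: lt_bigmin => // j _; rewrite divr_gt0.
suff : l + e <= l by rewrite gerDl leNgt e0.
apply: (lmax _ V); split=> [i||j]; first exact: ltW.
  apply: contraTneq e0 => V_eq0; have /rV0Pn[i _] := vn.
  by have := V0 i; rewrite V_eq0 mxE ltxx.
rewrite mulrDl -lerBrDl -ler_pdivlMr //; apply: le_trans (bigmin_le _ j _) _ => //.
by rewrite ler_pM2r ?invr_gt0 // !mxE.
Qed.

Definition simplex : set 'rV[R]_m :=
  [set v | (forall i, 0 <= v 0 i) /\ \sum_i v 0 i = 1].

Lemma simplex_normalize v : (forall i, 0 <= v 0 i) -> v != 0 ->
  simplex ((\sum_i v 0 i)^-1 *: v).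
Proof.
move=> v0 vn; have s0 := sumr_row_gt0 v0 vn; split=> [i|].
  by rewrite mxE mulr_ge0 // invr_ge0 ltW.
by under eq_bigr do rewrite mxE; rewrite -mulr_sumr mulVf // gt_eqF.
Qed.

Lemma continuous_row_sum (f : 'I_m -> 'rV[R]_m -> R) :
  (forall i, continuous (f i)) -> continuous (fun v => \sum_i f i v).
Proof. by move=> fc; apply: continuous_big => [|i _]; [exact: add_continuous|exact: fc]. Qed.

Lemma continuous_row_coord i : continuous (fun v : 'rV[R]_m => v 0 i).
Proof. exact: coord_continuous. Qed.

Lemma compact_simplex : compact simplex.
Proof.
have -> : simplex = [set v | forall i, [set` `[0 : R, 1]] (v 0 i)] `&`
    [set v | \sum_i v 0 i = 1].
  apply/seteqP; split=> v [v0 v1]; split=> // i.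
    rewrite /= in_itv /= v0 -v1 (bigD1 i) //= lerDl.
    exact: sumr_ge0.
  by have := v0 i; rewrite /= in_itv /= => /andP[].
apply: compact_closedI.
  by apply: (@rV_compact R m (fun=> [set` `[0 : R, 1]])) => i; exact: segment_compact.
apply: (@preimage_closed _ _ (fun v : 'rV[R]_m => \sum_i v 0 i) [set 1]).
  by move=> v _; apply: continuous_row_sum; exact: continuous_row_coord.
exact: closed_eq.
Qed.

Definition subeigen_slack M j (x : R * 'rV[R]_m) : R := (x.2 *m M) 0 j - x.1 * x.2 0 j.

Lemma continuous_subeigen_slack M j : continuous (subeigen_slack M j).
Proof.
have continuous_coord i : continuous (fun x : R * 'rV[R]_m => x.2 0 i).
  move=> x; apply: (cvg_comp snd (fun v : 'rV[R]_m => v 0 i) cvg_snd).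
  exact: continuous_row_coord.
move=> x; apply: cvgB; last by apply: cvgM; [exact: cvg_fst|exact: continuous_coord].
under eq_fun do rewrite mxE; rewrite mxE.
apply: (@cvg_big _ _ +%R) => [|i _]; first exact: add_continuous.
by apply: cvgM; [exact: continuous_coord|exact: cvg_cst].
Qed.

Definition subeigen_simplex M b : set (R * 'rV[R]_m) :=
  (`[0, b]%classic `*` simplex) `&` \bigcap_(j in setT) [set x | 0 <= subeigen_slack M j x].

Lemma compact_subeigen_simplex M b : compact (subeigen_simplex M b).
Proof.
apply: compact_closedI.
  by apply: compact_setX; [exact: segment_compact|exact: compact_simplex].
apply: closed_bigI => j _.
apply: (@preimage_closed _ _ (subeigen_slack M j) [set y | 0 <= y]).
  by move=> x _; exact: continuous_subeigen_slack.
exact: closed_ge.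
Qed.

Lemma exists_max_subeigen M : (0 < m)%N -> (forall i j, 0 <= M i j) ->
  exists l, exists2 v, subeigen M l v & forall k w, subeigen M k w -> k <= l.
Proof.
move=> m0 M0; set b := \sum_i \sum_j M i j.
have subeigen_normalize l v : 0 <= l -> subeigen M l v ->
    subeigen_simplex M b (l, (\sum_i v 0 i)^-1 *: v).
  move=> l0 lv; have [v0 vn _] := lv; split=> [|j _].
    split; last exact: simplex_normalize.
    by rewrite /= in_itv /= l0 (subeigen_le_sum M0 lv).
  have s0 : 0 < (\sum_i v 0 i)^-1 by rewrite invr_gt0 sumr_row_gt0.
  by have [_ _ /(_ j)] := subeigen_scale s0 lv; rewrite /subeigen_slack /= subr_ge0.
have one_subeigen : subeigen M 0 (const_mx 1).
  split=> [i||j]; first by rewrite mxE ler01.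
    by apply/rV0Pn; exists (Ordinal m0); rewrite mxE oner_neq0.
  by rewrite mul0r mulmx_row_ge0 // => i; rewrite mxE ler01.
have nonempty := ex_intro _ _ (subeigen_normalize _ _ (lexx 0) one_subeigen).
have [|[l v] lv_in lmax] :=
  compact_EVT_max nonempty (@compact_subeigen_simplex M b) (f := fst).
  by apply: continuous_subspaceT => x; exact: cvg_fst.
move: lv_in; rewrite inE => -[[/= l0b [v0 v1]] lv]; exists l, v.
  split=> // [|j]; last by have := lv j I; rewrite /subeigen_slack /= subr_ge0.
  apply: contra_eq_neq v1 => ->; rewrite big1 => [|i _]; last by rewrite mxE.
  by rewrite eq_sym oner_neq0.
move=> k w kw; have [k0|/ltW k0] := leP 0 k; last first.
  by apply: le_trans k0 _; move: l0b; rewrite in_itv /= => /andP[].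
exact: (lmax _ (mem_set (subeigen_normalize _ _ k0 kw))).
Qed.

Lemma perron_left M : (0 < m)%N -> irreducible_mx M ->
  exists l, exists2 v : 'rV[R]_m, forall i, 0 < v 0 i & v *m M = l *: v.
Proof.
move=> m0 Mirr; have [l [v lv lmax]] := exists_max_subeigen m0 Mirr.1.
have vE := max_subeigen_eigen Mirr lv lmax; exists l, v => //; case: lv => v0 vn _.
by apply: (subinvariant_gt0 (a := l) Mirr) => // j; rewrite vE mxE.
Qed.

Definition perron_pair M l v u : Prop :=
  [/\ forall i, 0 < v 0 i, forall i, 0 < u i 0, v *m M = l *: v & M *m u = l *: u].

Lemma row_gt0_neq0 v : (0 < m)%N -> (forall i, 0 < v 0 i) -> v != 0.
Proof. by move=> m0 v0; apply/rV0Pn; exists (Ordinal m0); rewrite gt_eqF. Qed.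

Lemma exists_perron_pair M : (0 < m)%N -> irreducible_mx M ->
  exists l v u, perron_pair M l v u.
Proof.
move=> m0 Mirr; have [l [v v0 vE]] := perron_left m0 Mirr.
have [k [u u0 uE]] := perron_left m0 (irreducible_mx_tr Mirr).
have {}uE : M *m u^T = k *: u^T by rewrite -(trmxK M) -trmx_mul uE linearZ.
have {}u0 i : 0 < u^T i 0 by rewrite mxE.
exists l, v, u^T; split=> //; suff -> : l = k by [].
have vu0 := mulmx_row_col_gt0 (fun i => ltW (v0 i)) (row_gt0_neq0 m0 v0) u0.
apply: (@mulIf _ ((v *m u^T) 0 0)); first by rewrite gt_eqF.
have /matrixP/(_ 0 0) : v *m M *m u^T = v *m (M *m u^T) by rewrite mulmxA.
by rewrite vE uE -scalemxAl -scalemxAr ![fun_of_matrix (_ *: _) 0 0]mxE.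
Qed.

Lemma perron_subeigen M l v u a w : perron_pair M l v u -> subeigen M a w -> a <= l.
Proof.
move=> [_ u0 _ uE] [w0 wn aw].
rewrite -(ler_pM2r (mulmx_row_col_gt0 w0 wn u0)).
have -> : a * (w *m u) 0 0 = ((a *: w) *m u) 0 0 by rewrite -scalemxAl [RHS]mxE.
have -> : l * (w *m u) 0 0 = ((w *m M) *m u) 0 0.
  by rewrite -mulmxA uE -scalemxAr [RHS]mxE.
by apply: ler_mulmx_row_col => i; [rewrite mxE|exact: ltW].
Qed.

Lemma perron_lt M N l v u k v' u' : (0 < m)%N ->
  perron_pair M l v u -> perron_pair N k v' u' ->
  (forall i j, M i j <= N i j) -> (exists i j, M i j < N i j) -> l < k.
Proof.
move=> m0 [v0 _ vE _] [_ u0 _ uE] MN [i [j Mij]].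
have vM_le h : (v *m M) 0 h <= (v *m N) 0 h.
  by rewrite !mxE; apply: ler_sum => n _; rewrite ler_wpM2l // ltW.
have vM_lt : (v *m M) 0 j < (v *m N) 0 j.
  rewrite !mxE (bigD1 i) //= [ltRHS](bigD1 i) //= ltr_leD ?ltr_pM2l //.
  by apply: ler_sum => n _; rewrite ler_wpM2l // ltW.
have vu0 := mulmx_row_col_gt0 (fun i => ltW (v0 i)) (row_gt0_neq0 m0 v0) u0.
rewrite -(ltr_pM2r vu0).
have -> : l * (v *m u') 0 0 = (v *m M *m u') 0 0 by rewrite vE -scalemxAl [RHS]mxE.
have -> : k * (v *m u') 0 0 = (v *m N *m u') 0 0.
  by rewrite -mulmxA uE -scalemxAr [RHS]mxE.
exact: ltr_mulmx_row_col vM_le vM_lt u0.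
Qed.

Lemma perron_largest_eigenvalue M l v u : (0 < m)%N -> (forall i j, 0 <= M i j) ->
  perron_pair M l v u -> largest_real_eigenvalue (map_mx (real_complex R) M) l.
Proof.
move=> m0 M0 pp; have [v0 _ vE _] := pp; split.
  rewrite eigenvalue_map; apply/eigenvalueP; exists v => //.
  exact: row_gt0_neq0.
move=> k; rewrite eigenvalue_map => /eigenvalueP[y yE yn].
apply: le_trans (ler_norm k) _.
apply: (perron_subeigen (w := \row_i `|y 0 i|) pp); split=> [i||j].
- by rewrite mxE.
- by have /rV0Pn[i yi] := yn; apply/rV0Pn; exists i; rewrite mxE normr_eq0.
rewrite mxE -normrM; have /matrixP/(_ 0 j) := yE; rewrite ![in X in X -> _]mxE => <-.
rewrite (le_trans (ler_norm_sum _ _ _)) // mxE; apply: ler_sum => i _.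
by rewrite normrM mxE [X in _ * X]ger0_norm.
Qed.

End PerronFrobenius.

(** * Periods and roots of unity *)

Section Periods.

Lemma dvdn_gcd_setP (S : set nat) e :
  (e %| gcd_set S)%N <-> forall s, S s -> (e %| s)%N.
Proof.
have [dS dmax] : (forall s, S s -> (gcd_set S %| s)%N) /\
    forall d, (forall s, S s -> (d %| s)%N) -> (d %| gcd_set S)%N.
  apply: (@getPex _ [set d | (forall s, S s -> (d %| s)%N) /\
    forall d', (forall s, S s -> (d' %| s)%N) -> (d' %| d)%N]).
  have [S0|/existsNP[s0 /not_implyP[Ss0 /eqP]]] := pselect (forall s, S s -> s = 0%N).
    by exists 0%N; split => [s /S0->|].
  rewrite -lt0n => s0_gt0.
  pose multiple d := `[< (0 < d)%N /\ forall e, (forall s, S s -> (e %| s)%N) -> (e %| d)%N >].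
  have [|d /asboolP[d0 dP] dmin] := @ex_minnP multiple.
    by exists s0; apply/asboolP; split=> // d; exact.
  exists d; split=> // s Ss; apply/gcdn_idPl; apply/eqP; rewrite eqn_leq.
  rewrite dvdn_leq ?dvdn_gcdl //=; apply: dmin; apply/asboolP; split.
    by rewrite gcdn_gt0 d0.
  by move=> d' d'S; rewrite dvdn_gcd dP //= d'S.
by split=> [eS s /dS|]; [exact: dvdn_trans|exact: dmax].
Qed.

Lemma exists_expr_order (L : nzRingType) (w : L) :
  exists d, forall k, (w ^+ k == 1) = (d %| k)%N.
Proof.
have [[p p0 wp]|no] := pselect (exists2 p, (0 < p)%N & w ^+ p = 1).
  by have [d /prim_order_dvd dP _] := prim_order_exists p0 wp; exists d => k; rewrite dP.
exists 0%N => k; rewrite dvd0n; have [->|k0] := posnP k; first by rewrite expr0 eqxx.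
by apply/eqP => wk; apply: no; exists k.
Qed.

Variable K : nzRingType.
Implicit Types f : fps K.

Lemma fps_valP f n : f n != 0 ->
  f (fps_val f) != 0 /\ forall k, f k != 0 -> (fps_val f <= k)%N.
Proof.
move=> fn; apply: (@getPex _ [set v | fps_supp f v /\
  forall n, fps_supp f n -> (v <= n)%N]).
have [|v fv vmin] := @ex_minnP (fun n => f n != 0); first by exists n.
by exists v.
Qed.

Lemma dvdn_fps_periodP f e :
  (e %| fps_period f)%N <-> forall n, f n != 0 -> (e %| n - fps_val f)%N.
Proof.
rewrite dvdn_gcd_setP; split=> [ef n fn|ef _ [n fn <-]]; last exact: ef.
by apply: ef; exists n.
Qed.

Lemma fps_period_dvd f n : f n != 0 -> (fps_period f %| n - fps_val f)%N.
Proof. by apply: (dvdn_fps_periodP f _).1; exact: dvdnn. Qed.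

Lemma expr_dvdn_fps_period f (L : fieldType) (w : L) d :
  w != 0 -> (forall k, (w ^+ k == 1) = (d %| k)%N) ->
  (forall n k, f n != 0 -> f k != 0 -> w ^+ n = w ^+ k) -> (d %| fps_period f)%N.
Proof.
move=> w0 dP wf; apply/dvdn_fps_periodP => n fn; have [fv vmin] := fps_valP fn.
rewrite -dP; apply/eqP/(mulIf (expf_neq0 (fps_val f) w0)).
by rewrite -exprD subnK ?vmin // mul1r; exact: wf.
Qed.

End Periods.

Section UnitCircle.
Variable R : realType.
Local Open Scope complex_scope.

Lemma expiD (a b : R) : expi (a + b) = expi a * expi b.
Proof.
rewrite /expi cosD sinD; simpc; congr (_ +i* _).
by rewrite addrC [cos a * _]mulrC.
Qed.

Lemma expi0 : expi (0 : R) = 1.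
Proof. by rewrite /expi cos0 sin0. Qed.

Lemma expiX (a : R) k : expi a ^+ k = expi (a * k%:R).
Proof.
elim: k => [|k IH]; first by rewrite mulr0 expi0 expr0.
by rewrite exprS IH -expiD -natr1 mulrDr mulr1 addrC.
Qed.

Lemma expi_2pi : expi (2 * pi) = 1 :> R[i].
Proof.
have -> : 2 * pi = pi + pi :> R by ring.
by rewrite expiD /expi cospi sinpi; simpc.
Qed.

Lemma expi_neq1 (a : R) : 0 < a < 2 * pi -> expi a != 1.
Proof.
move=> /andP[a0 a2]; apply/eqP => -[cosa _].
have sin_half_gt0 : 0 < sin (a / 2).
  by apply: sin_gt0_pi; rewrite divr_gt0 //= ltr_pdivrMr // mulrC.
have sin_half_eq0 : sin (a / 2) ^+ 2 = 0.
  have := cosD (a / 2) (a / 2); rewrite -splitr cosa -!expr2 => cos_double.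
  by have := cos2Dsin2 (a / 2); lra.
by move/eqP: sin_half_eq0; rewrite sqrf_eq0 gt_eqF.
Qed.

Lemma root_of_unity_expi (w : R[i]) q : (0 < q)%N -> w ^+ q = 1 ->
  exists2 k, (k < q)%N & w = expi (2 * pi * k%:R / q%:R).
Proof.
move=> q0 wq; pose z : R[i] := expi (2 * pi / q%:R).
have qR_gt0 : (0 : R) < q%:R by rewrite ltr0n.
have zE k : z ^+ k = expi (2 * pi * k%:R / q%:R) by rewrite /z expiX mulrAC.
have z_primitive : q.-primitive_root z.
  rewrite /primitive_root_of_unity q0 /=; apply/forallP => -[i iq] /=.
  rewrite unity_rootE zE; have [->|neq] := eqVneq i.+1 q.
    have -> : 2 * pi * q%:R / q%:R = 2 * pi :> R by rewrite mulfK // gt_eqF.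
    by rewrite expi_2pi eqxx.
  rewrite (negbTE (expi_neq1 _)) // divr_gt0 ?mulr_gt0 ?pi_gt0 //=.
  rewrite ltr_pdivrMr // ltr_pM2l ?mulr_gt0 ?pi_gt0 // ltr_nat.
  by rewrite ltn_neqAle neq iq.
by have [i ->] := prim_rootP z_primitive wq; exists i => //; rewrite zE.
Qed.

End UnitCircle.

(** * The critical point and the radius of the solution *)

Section NonnegativeSolutions.
Variable K : numFieldType.

Variables (m p : nat) (A Y : 'M[fps K]_(m, p)) (B : 'M[fps K]_m).
Hypotheses (A_nneg : mx_nneg A) (B_nneg : mx_nneg B).
Hypotheses (B0_nil : is_nilpotent (map_mx (@fps_coef0 K) B)) (YE : Y = A + B *m Y).

Lemma solution_coefE i j n :
  Y i j n = A i j n + \sum_l \sum_(a < n.+1) B i l a * Y l j (n - a)%N.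
Proof. by rewrite {1}YE mxE [LHS]/= mx_fps_mulE. Qed.

Lemma solution_nneg : mx_nneg Y.
Proof.
have expB_nneg h : mx_nneg (B ^+ h).
  elim: h => [|h IH]; first exact: mx_nneg1.
  by rewrite exprS; exact: mx_nnegM.
move=> i j n; have [k /exp_coef_eq0 Bk] := B0_nil.
rewrite (neumann_expansion (k * n.+1) YE) mxE [leRHS]/=.
rewrite [fun_of_matrix (B ^+ _ *m Y) i j n]mulmx_coef_eq0 ?addr0 => [|i' j' a an].
  apply: mx_nnegM => // i' j' a; rewrite summxE fps_sumE sumr_ge0 // => h _.
  exact: expB_nneg.
by apply: (Bk n.+1); rewrite ?ltnS.
Qed.

Lemma solution_ge_inhomogeneous i j n : A i j n <= Y i j n.
Proof.
rewrite solution_coefE lerDl sumr_ge0 // => l _; rewrite sumr_ge0 // => a _.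
by rewrite mulr_ge0 ?B_nneg ?solution_nneg.
Qed.

Lemma solution_ge_product i l j a b : B i l a * Y l j b <= Y i j (a + b)%N.
Proof.
have term0 k c n : 0 <= B i k c * Y k j n by rewrite mulr_ge0 ?B_nneg ?solution_nneg.
have ab : (a < (a + b).+1)%N by rewrite ltnS leq_addr.
apply: le_trans (_ : \sum_(c < (a + b).+1) B i l c * Y l j (a + b - c)%N <= _).
  by rewrite (bigD1 (Ordinal ab)) //= addKn lerDl sumr_ge0.
rewrite solution_coefE (bigD1 l) //= addrCA lerDl addr_ge0 ?A_nneg //.
by rewrite sumr_ge0 // => k _; rewrite sumr_ge0.
Qed.

End NonnegativeSolutions.

Section CriticalPoint.
Variables (R : realType) (m : nat) (P : 'M[fps R]_m).
Hypotheses (P_nneg : mx_nneg P) (P0_nil : is_nilpotent (map_mx (@fps_coef0 R) P)).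
Hypothesis P_nonconst : exists i j n, (0 < n)%N /\ P i j n != 0.
Hypothesis P_conn : forall i j, connect (mx_dependency P) i j.
Implicit Types (x y r : R) (v : 'rV[R]_m) (u w : 'cV[R]_m).

Lemma nonconstant_dim_gt0 : (0 < m)%N.
Proof. by have [i _] := P_nonconst; exact: leq_ltn_trans (leq0n i) (ltn_ord i). Qed.

Lemma irreducible_mx_eval x : 0 < x -> mx_cvg P x -> irreducible_mx (mx_eval P x).
Proof.
move=> x0 Px; split; first by apply: mx_eval_ge0 => //; exact: ltW.
move=> i j; apply: (@connect_sub _ (mx_dependency P)); last exact: P_conn.
move=> k l /fps_neq0P[n Pn]; apply: connect1; rewrite /mx_dependency /= mxE.
by rewrite gt_eqF // (fps_eval_gt0 _ _ _ Pn).
Qed.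

Lemma exists_perron_pair_eval x : 0 < x -> mx_cvg P x ->
  exists l v u, perron_pair (mx_eval P x) l v u.
Proof.
move=> x0 Px; apply: exists_perron_pair; first exact: nonconstant_dim_gt0.
exact: irreducible_mx_eval.
Qed.

Lemma perron_eval_lt x y l v u k v' u' : 0 <= x -> x < y -> mx_cvg P y ->
  perron_pair (mx_eval P x) l v u -> perron_pair (mx_eval P y) k v' u' -> l < k.
Proof.
move=> x0 xy Py pl pk; apply: perron_lt pl pk _ _; first exact: nonconstant_dim_gt0.
  by apply: ler_mx_eval => //; exact: ltW.
have [i [j [n [n0 Pn]]]] := P_nonconst; exists i, j; rewrite !mxE.
exact: fps_eval_lt n0 Pn.
Qed.

Definition admissible x : Prop :=
  mx_cvg P x /\
  exists2 u : 'cV[R]_m, (forall i, 0 < u i 0) & forall i, (mx_eval P x *m u) i 0 <= u i 0.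

Lemma admissible_le x y : 0 <= x -> x <= y -> admissible y -> admissible x.
Proof.
move=> x0 xy [Py [u u0 uE]]; split; first exact: mx_nneg_cvg_le Py.
exists u => // i; apply: le_trans (uE i); rewrite ![_ i 0]mxE.
by apply: ler_sum => j _; rewrite ler_wpM2r ?(ltW (u0 _)) //; exact: ler_mx_eval.
Qed.

Lemma mx_eval_convex x y t u i : 0 <= x -> x <= y -> 0 <= t <= 1 -> mx_cvg P y ->
  (forall j, 0 <= u j 0) -> (mx_eval P (t * y + (1 - t) * x) *m u) i 0 <=
    t * (mx_eval P y *m u) i 0 + (1 - t) * (mx_eval P x *m u) i 0.
Proof.
move=> x0 xy t01 Py u0; have /andP[t0 t1] := t01; have y0 := le_trans x0 xy.
have tyx0 : 0 <= t * y + (1 - t) * x by rewrite addr_ge0 ?mulr_ge0 ?subr_ge0.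
have tyxy : t * y + (1 - t) * x <= y.
  by have := mulr_ge0 (_ : 0 <= 1 - t) (_ : 0 <= y - x); rewrite !subr_ge0; nra.
rewrite ![_ i 0]mxE !mulr_sumr -big_split; apply: ler_sum => j _ /=.
rewrite !mulrA -mulrDl ler_wpM2r //; rewrite !mxE.
have Px := mx_nneg_cvg_le P_nneg x0 xy Py; have Pt := mx_nneg_cvg_le P_nneg tyx0 tyxy Py.
exact: (fps_eval_convex (P_nneg i j) y0 x0 t01 (Py i j) (Px i j) (Pt i j)).
Qed.

Lemma admissible_extend x y u : 0 <= x -> x < y -> mx_cvg P y ->
  (forall i, 0 < u i 0) -> (forall i, (mx_eval P x *m u) i 0 < u i 0) ->
  exists2 z, x < z & admissible z.
Proof.
move=> x0 xy Py u0 ux.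
pose ev_y i := (mx_eval P y *m u) i 0; pose ev_x i := (mx_eval P x *m u) i 0.
pose t := \big[Num.min/1]_i ((u i 0 - ev_x i) / (1 + `|ev_y i - ev_x i|)).
have t0 : 0 < t by apply: lt_bigmin => // i _; rewrite divr_gt0 // subr_gt0; exact: ux.
have t01 : 0 <= t <= 1 by rewrite ltW //= bigmin_le_id.
have gap i : t * (1 + `|ev_y i - ev_x i|) <= u i 0 - ev_x i.
  by rewrite -ler_pdivlMr //; exact: bigmin_le.
have zE : t * y + (1 - t) * x = x + t * (y - x) by ring.
have tyx : t * (y - x) <= y - x by rewrite ler_piMl ?subr_ge0 ?(ltW xy) //; case/andP: t01.
exists (t * y + (1 - t) * x); first by rewrite zE ltrDl mulr_gt0 ?subr_gt0.
split; first apply: (mx_nneg_cvg_le P_nneg _ _ Py); rewrite ?zE.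
- by rewrite addr_ge0 // mulr_ge0 ?(ltW t0) ?subr_ge0 ?(ltW xy).
- by rewrite -lerBrDl.
exists u => // i; rewrite -zE.
apply: le_trans (mx_eval_convex i x0 (ltW xy) t01 Py (fun j => ltW (u0 j))) _.
have := gap i; have := ler_wpM2l (ltW t0) (ler_norm (ev_y i - ev_x i)).
rewrite /ev_y /ev_x !mulrDr mulr1; lra.
Qed.

(* [u] solves [u = 1 + P(0) u], which exists because P(0) is nilpotent. *)
Lemma admissible_small y : 0 < y -> mx_cvg P y -> exists2 x, 0 < x & admissible x.
Proof.
move=> y0 Py; have P0E := mx_eval0 P; set P0 := map_mx _ P in P0E.
have [k P0k] := P0_nil; rewrite -/P0 in P0k.
have P0_ge0 i j : 0 <= P0 i j by rewrite mxE; exact: P_nneg.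
pose u : 'cV[R]_m := (\sum_(h < k) P0 ^+ h) *m const_mx 1.
have uE : u = const_mx 1 + P0 *m u.
  rewrite /u mulmxA -[X in _ = X + _]mul1mx -mulmxDl; congr (_ *m _).
  rewrite -[P0 *m _]/(P0 * _) mulr_sumr; under [in RHS]eq_bigr do rewrite -exprS.
  by rewrite -[1%:M]/(P0 ^+ 0) -(big_ord_recl _ (fun h => P0 ^+ h)) big_ord_recr /= P0k addr0.
have u_ge0 i : 0 <= u i 0.
  rewrite mxE sumr_ge0 // => j _; rewrite mxE mulr1 summxE sumr_ge0 // => h _.
  exact: expmx_ge0.
have P0u_lt i : (mx_eval P 0 *m u) i 0 < u i 0.
  by rewrite P0E {2}uE [ltRHS]mxE [const_mx _ _ _]mxE ltrDr.
apply: (@admissible_extend 0 y u) => // i; apply: le_lt_trans (P0u_lt i).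
by rewrite P0E mxE sumr_ge0 // => j _; rewrite mulr_ge0.
Qed.

Lemma connect_row_le x0 i j : 0 < x0 -> mx_cvg P x0 ->
  exists2 c, 0 < c & forall x u, x0 <= x -> mx_cvg P x -> (forall k, 0 < u k 0) ->
    (forall k, (mx_eval P x *m u) k 0 <= u k 0) -> c * u i 0 <= u j 0.
Proof.
move=> x00 Px0; have [M0 Mc] := irreducible_mx_eval x00 Px0.
have /connectP[p] := Mc j i; elim: p j => [|k p IH] j /=.
  by move=> _ ->; exists 1 => // x u _ _ _ _; rewrite mul1r.
case/andP=> Mjk pp /(IH _ pp)[c c0 cP]; exists (mx_eval P x0 j k * c).
  by rewrite mulr_gt0 // lt_def M0 andbT.
move=> x u x0x Px u0 uE; have x_ge0 : 0 <= x by rewrite (le_trans _ x0x) // ltW.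
apply: le_trans (uE j); rewrite -mulrA [leRHS]mxE (bigD1 k) //= ler_wpDr //.
  by rewrite sumr_ge0 // => l _; rewrite mulr_ge0 ?mx_eval_ge0 // ltW.
rewrite ler_pM ?M0 ?mulr_ge0 ?(ltW c0) ?(ltW (u0 _)) //; last exact: cP Px u0 uE.
by apply: ler_mx_eval => //; exact: ltW.
Qed.

(* Going round a cycle through the entry (i, j) bounds it independently of x. *)
Lemma admissible_entry_bounded x0 i j : 0 < x0 -> admissible x0 ->
  exists b, forall x, x0 <= x -> admissible x -> mx_eval P x i j <= b.
Proof.
move=> x00 [Px0 _]; have [c c0 cP] := connect_row_le i j x00 Px0.
exists c^-1 => x x0x [Px [u u0 uE]]; have x_ge0 : 0 <= x by rewrite (le_trans _ x0x) // ltW.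
rewrite -[c^-1]mul1r ler_pdivlMr // -(ler_pM2r (u0 i)) mul1r -mulrA.
apply: le_trans (uE i); rewrite [leRHS]mxE (bigD1 j) //= ler_wpDr //.
  by rewrite sumr_ge0 // => l _; rewrite mulr_ge0 ?mx_eval_ge0 // ltW.
by rewrite ler_wpM2l ?mx_eval_ge0 //; exact: cP Px u0 uE.
Qed.

Lemma admissible_has_ubound x0 : 0 < x0 -> admissible x0 -> has_ubound admissible.
Proof.
move=> x00 adm0; have [i [j [n [n0 Pn]]]] := P_nonconst.
have [b bP] := admissible_entry_bounded i j x00 adm0.
have Pn0 : 0 < P i j n by rewrite lt_def Pn P_nneg.
exists (Num.max (Num.max 1 x0) (b / P i j n)) => x adm.
have [x_le|] := leP x (Num.max 1 x0); first by rewrite le_max x_le.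
rewrite gt_max => /andP[/ltW x1 /ltW x0x]; rewrite le_max ler_pdivlMr //.
apply/orP; right; apply: le_trans (bP x x0x adm); rewrite mxE.
have x_ge0 : 0 <= x by exact: le_trans x1.
apply: le_trans (fps_term_le_eval n (P_nneg i j) x_ge0 (adm.1 i j)).
by rewrite mulrC ler_wpM2l ?P_nneg // -{1}[x]expr1 ler_weXn2l.
Qed.

Section Supremum.
Variables (x0 r : R).
Hypotheses (x0_gt0 : 0 < x0) (x0_adm : admissible x0) (x0r : x0 <= r).
Hypothesis adm_below : forall x, 0 <= x -> x < r -> admissible x.

Lemma supremum_cvg : mx_cvg P r.
Proof.
have r0 : 0 < r by exact: lt_le_trans x0r.
move=> i j; have [b bP] := admissible_entry_bounded i j x0_gt0 x0_adm.
have bound x : 0 <= x -> x < r -> mx_eval P x i j <= Num.max b (mx_eval P x0 i j).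
  move=> x_ge0 xr; rewrite le_max; have [x0x|/ltW xx0] := leP x0 x.
    by rewrite bP //; exact: adm_below.
  by rewrite (ler_mx_eval P_nneg x_ge0 xx0 x0_adm.1) orbT.
apply: (fps_series_bounded_cvg (P_nneg i j) (ltW r0)) => N.
have cvgN : fps_series (P i j) x N @[x --> r^'-] --> fps_series (P i j) r N.
  by apply: cvg_at_left_filter; exact: fps_series_continuous.
apply: cvgr_to_le cvgN _; near=> x.
have x_ge0 : 0 <= x by near: x; exact: nbhs_left_ge.
have xr : x < r by near: x; exact: nbhs_left_lt.
apply: le_trans (bound x x_ge0 xr); rewrite mxE.
by apply: fps_series_le_eval => //; exact: (adm_below x_ge0 xr).1.
Unshelve. all: by end_near. Qed.

(* Otherwise v P(x) > v for some x < r by left continuity, against P(x) w <= w. *)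
Lemma supremum_perron_le1 l v u : perron_pair (mx_eval P r) l v u -> l <= 1.
Proof.
have r0 : 0 < r by exact: lt_le_trans x0r.
move=> [v0 _ vE _]; rewrite leNgt; apply/negP => l1.
have near_gt : \forall t \near 1^'-, forall j, v 0 j < (v *m mx_eval P (t * r)) 0 j.
  apply: filter_forall => j.
  have cvg_j : (v *m mx_eval P (t * r)) 0 j @[t --> 1^'-] --> (v *m mx_eval P r) 0 j.
    under eq_fun do rewrite mxE; rewrite mxE.
    apply: (@cvg_big _ _ +%R) => [|i _]; first exact: add_continuous.
    apply: cvgM; first exact: cvg_cst.
    under eq_fun do rewrite mxE; rewrite mxE.
    by apply: fps_eval_abel => //; [exact: ltW|exact: supremum_cvg].
  by apply: (cvgr_gt _ cvg_j); rewrite vE mxE ltr_pMl.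
have [t [[t0 t1] vt]] : exists t, (0 <= t /\ t < 1) /\
    forall j, v 0 j < (v *m mx_eval P (t * r)) 0 j.
  apply: (@filter_ex _ 1^'-); near=> t; split; last by near: t.
  by split; near: t; [exact: nbhs_left_ge|exact: nbhs_left_lt].
have tr0 : 0 <= t * r by rewrite mulr_ge0 // ltW.
have tr : t * r < r by rewrite gtr_pMl.
have [_ [w w0 wE]] := adm_below tr0 tr.
have := ltr_mulmx_row_col (fun j => ltW (vt j)) (vt (Ordinal nonconstant_dim_gt0)) w0.
apply/negP; rewrite -leNgt -mulmxA [leLHS]mxE [leRHS]mxE; apply: ler_sum => i _.
by rewrite ler_wpM2l // ltW.
Unshelve. all: by end_near. Qed.

End Supremum.

Definition critical r l v u : Prop :=
  [/\ 0 < r, mx_cvg P r, perron_pair (mx_eval P r) l v u, l <= 1 &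
      l < 1 -> forall y, r < y -> ~ mx_cvg P y].

Lemma exists_critical y : 0 < y -> mx_cvg P y -> exists r l v u, critical r l v u.
Proof.
move=> y0 Py; have [x0 x00 adm0] := admissible_small y0 Py.
have has_sup_adm : has_sup admissible.
  by split; [exists x0|exact: admissible_has_ubound adm0].
pose r := sup admissible.
have x0r : x0 <= r by apply: ub_le_sup adm0; exact: has_sup_adm.2.
have r0 : 0 < r by exact: lt_le_trans x0r.
have adm_below x : 0 <= x -> x < r -> admissible x.
  move=> x_ge0; rewrite -subr_gt0 => /sup_adherent/(_ has_sup_adm)[z adm_z].
  by rewrite subKr => /ltW xz; exact: admissible_le adm_z.
have Pr := supremum_cvg x00 adm0 x0r adm_below.
have [l [v [u pp]]] := exists_perron_pair_eval r0 Pr.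
exists r, l, v, u; split=> //; first exact: (supremum_perron_le1 x00 adm0 x0r adm_below pp).
move=> l1 z rz Pz; have [_ u0 _ uE] := pp.
have Pu i : (mx_eval P r *m u) i 0 < u i 0 by rewrite uE mxE gtr_pMl.
have [s rs adm_s] := admissible_extend (ltW r0) rz Pz u0 Pu.
by have := ub_le_sup has_sup_adm.2 adm_s; rewrite leNgt rs.
Qed.

Lemma critical_perron_below r l v u x : critical r l v u -> 0 < x -> x <= r ->
  exists k v' u', [/\ perron_pair (mx_eval P x) k v' u', k <= 1 & k = 1 -> x = r /\ l = 1].
Proof.
move=> [r0 Pr pl l1 _] x0; rewrite le_eqVlt => /predU1P[->|xr]; first by exists l, v, u.
have [k [v' [u' pk]]] := exists_perron_pair_eval x0 (mx_nneg_cvg_le P_nneg (ltW x0) (ltW xr) Pr).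
have k1 : k < 1 := lt_le_trans (perron_eval_lt (ltW x0) xr Pr pk pl) l1.
by exists k, v', u'; split=> //; [exact: ltW|move=> k1'; rewrite k1' ltxx in k1].
Qed.

(* Pairing the equation with the left eigenvector v leaves v a(x) = 0. *)
Lemma perron1_solution_eq0 (a y : 'cV[fps R]_m) x v u : 0 < x -> mx_nneg a ->
  y = a + P *m y -> mx_cvg P x -> mx_cvg y x -> perron_pair (mx_eval P x) 1 v u -> a = 0.
Proof.
move=> x0 a_nneg yE Px yx [v0 _ vP _]; have y_nneg := solution_nneg a_nneg P_nneg P0_nil yE.
have ax : mx_cvg a x.
  move=> i j; apply: (fps_nneg_cvg_le (a_nneg i j) _ (ltW x0) (lexx x) (yx i j)) => n.
  exact: (solution_ge_inhomogeneous a_nneg P_nneg P0_nil yE).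
have Pyx := mx_nneg_cvgM P_nneg (ltW x0) y_nneg Px yx.
have y_eval : mx_eval y x = mx_eval a x + mx_eval P x *m mx_eval y x.
  by rewrite {1}yE (mx_evalD ax Pyx) (mx_nneg_evalM P_nneg (ltW x0) y_nneg Px yx).
have /matrixP/(_ 0 0) : v *m mx_eval a x = 0.
  apply: (addIr (v *m mx_eval y x)).
  by rewrite add0r {2}y_eval mulmxDr mulmxA vP scale1r.
rewrite !mxE => /eqP; rewrite psumr_eq0 => [/allP va|i _]; last first.
  by rewrite mulr_ge0 ?(ltW (v0 _)) // mxE fps_eval_ge0 // ltW.
apply/matrixP => i j; rewrite mxE ord1; apply: fpsP => n.
have := va i (mem_index_enum i); rewrite mulf_eq0 (gt_eqF (v0 i)) mxE /=.
by apply: contraTeq => an; rewrite gt_eqF // (fps_eval_gt0 (a_nneg i 0) x0 (ax i 0) an).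
Qed.

End CriticalPoint.

Section NonnegativeCoefficients.
Variable R : realType.
Local Notation C := R[i].
Local Open Scope complex_scope.
Implicit Types (f g : fps C) (x : R).

Lemma fps_abs_nnegE f n : fps_nneg f -> (fps_abs f n)%:C = f n.
Proof. by move=> f0; exact: ge0_normc. Qed.

Lemma fps_series_nneg f x N : fps_nneg f ->
  fps_series f x%:C N = (fps_series (fps_abs f) x N)%:C.
Proof.
move=> f0; rewrite !fps_seriesE rmorph_sum; apply: eq_bigr => k _.
by rewrite rmorphM rmorphXn /= ge0_normc.
Qed.

Lemma fps_cvg_nneg f x : fps_nneg f -> 0 <= x ->
  fps_cvg f x%:C <-> fps_cvg (fps_abs f) x.
Proof.
move=> f0 x0; have normx : normc x%:C = x by rewrite normc_real ger0_norm.
split=> fx; last by apply: fps_abs_cvg_fps_cvg; rewrite normx.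
rewrite /fps_cvg; have <- : (fun N => normc (fps_series f x%:C N)) = fps_series (fps_abs f) x.
  apply/funext => N; rewrite (fps_series_nneg _ _ f0) normc_real ger0_norm //.
  by apply: fps_series_ge0 => //; exact: fps_abs_nneg.
by apply: (cvgP (normc (fps_eval f x%:C))); apply: cvg_normc; exact: fx.
Qed.

Lemma fps_eval_nneg f x : fps_nneg f -> 0 <= x -> fps_cvg (fps_abs f) x ->
  fps_eval f x%:C = (fps_eval (fps_abs f) x)%:C.
Proof.
move=> f0 x0 fx; apply: fps_eval_eq.
apply: (@cvgc_squeeze _ _ _ _ _ _
  (fun N => fps_eval (fps_abs f) x - fps_series (fps_abs f) x N)).
  apply: nearW => N; rewrite (fps_series_nneg _ _ f0) -rmorphB normc_real distrC ger0_norm //.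
  by rewrite subr_ge0 fps_series_le_eval //; exact: fps_abs_nneg.
rewrite -(subrr (fps_eval (fps_abs f) x)); exact: (cvgB (cvg_cst _) fx).
Qed.

Lemma fps_absD f g : fps_nneg f -> fps_nneg g -> fps_abs (f + g) = fps_abs f + fps_abs g.
Proof.
move=> f0 g0; apply: fpsP => n; apply: complexI.
rewrite fps_abs_nnegE => [|k]; last exact: addr_ge0.
by rewrite rmorphD /= !ge0_normc.
Qed.

Lemma fps_absM f g : fps_nneg f -> fps_nneg g -> fps_abs (f * g) = fps_abs f * fps_abs g.
Proof.
move=> f0 g0; apply: fpsP => n; apply: complexI.
rewrite fps_abs_nnegE; last exact: fps_nnegM.
rewrite !fps_mulE rmorph_sum; apply: eq_bigr => i _.
by rewrite rmorphM /= !ge0_normc.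
Qed.

Lemma fps_abs_sum (I : Type) (r : seq I) (F : I -> fps C) :
  (forall i, fps_nneg (F i)) -> fps_abs (\sum_(i <- r) F i) = \sum_(i <- r) fps_abs (F i).
Proof.
move=> F0; elim: r => [|i r IH].
  by rewrite !big_nil; apply: fpsP => n; exact: normc0.
rewrite !big_cons fps_absD ?IH // => n; rewrite fps_sumE sumr_ge0 // => k _.
exact: F0.
Qed.

Lemma mx_cvg_nneg p q (M : 'M[fps C]_(p, q)) x : mx_nneg M -> 0 <= x ->
  mx_cvg M x%:C <-> mx_cvg (mx_abs M) x.
Proof.
move=> M0 x0; split=> Mx i j.
  by rewrite mxE; apply: (fps_cvg_nneg (M0 i j) x0).1; exact: Mx.
by have := Mx i j; rewrite mxE => /(fps_cvg_nneg (M0 i j) x0).2.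
Qed.

Lemma mx_eval_nneg p q (M : 'M[fps C]_(p, q)) x : mx_nneg M -> 0 <= x ->
  mx_cvg (mx_abs M) x -> mx_eval M x%:C = map_mx (real_complex R) (mx_eval (mx_abs M) x).
Proof.
move=> M0 x0 /mx_abs_cvgP Mx; apply/matrixP => i j; rewrite !mxE.
exact: (fps_eval_nneg (M0 i j) x0 (Mx i j)).
Qed.

Lemma mx_abs_affine m p (A Y : 'M[fps C]_(m, p)) (B : 'M[fps C]_m) :
  mx_nneg A -> mx_nneg B -> mx_nneg Y ->
  mx_abs (A + B *m Y) = mx_abs A + mx_abs B *m mx_abs Y.
Proof.
move=> A0 B0 Y0; apply/matrixP => i j; rewrite !mxE (fps_absD (A0 i j)); last first.
  by have := mx_nnegM B0 Y0 i j; rewrite mxE.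
congr (_ + _); rewrite fps_abs_sum => [|k]; last exact: fps_nnegM (B0 i k) (Y0 k j).
by apply: eq_bigr => k _; rewrite !mxE fps_absM.
Qed.

Lemma fps_abs_eq0 f : (fps_abs f == 0) = (f == 0).
Proof.
apply/eqP/eqP => [f0|->]; last by apply: fpsP => n; exact: normc0.
by apply: fpsP => n; have /eqP := congr1 (fun g : fps R => g n) f0; rewrite normc_eq0 => /eqP.
Qed.

Section SquareMatrix.
Variables (m : nat) (B : 'M[fps C]_m).

Lemma mx_abs_dependency : mx_dependency (mx_abs B) =2 dependency B.
Proof. by move=> i j; rewrite /mx_dependency /= mxE fps_abs_eq0. Qed.

Lemma mx_abs_coef0_nilpotent : mx_nneg B -> is_nilpotent (map_mx (@fps_coef0 C) B) ->
  is_nilpotent (map_mx (@fps_coef0 R) (mx_abs B)).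
Proof.
move=> B0 [k Bk]; exists k; apply: (map_mx_inj (f := real_complex R)).
rewrite raddf0 -Bk rmorphXn; congr (_ ^+ k).
by apply/matrixP => i j; rewrite !mxE; exact: fps_abs_nnegE.
Qed.

Lemma abs_nonconstant_entry : is_nilpotent (map_mx (@fps_coef0 C) B) -> ~ is_nilpotent B ->
  exists i j n, (0 < n)%N /\ mx_abs B i j n != 0.
Proof.
move=> B0_nil B_rec; have [i [j [n [n0 Bn]]]] := exists_nonconstant_entry B0_nil B_rec.
by exists i, j, n; rewrite mxE /= normc_eq0.
Qed.

Lemma abs_connected : (forall i j, connect (dependency B) i j) ->
  forall i j, connect (mx_dependency (mx_abs B)) i j.
Proof. by move=> B_conn i j; rewrite (eq_connect mx_abs_dependency). Qed.

Variables (r l : R) (v : 'rV[R]_m) (u : 'cV[R]_m).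
Hypothesis crit : critical (mx_abs B) r l v u.

Lemma critical_le_radius : (r%:E <= mx_radius B)%E.
Proof. by have [r0 Br _ _ _] := crit; exact: mx_abs_cvg_le_radius (ltW r0) Br. Qed.

Lemma critical_lt1_radius : l < 1 -> mx_radius B = r%:E.
Proof.
have [r0 _ _ _ beyond] := crit; move=> /beyond no_cvg.
apply/eqP; rewrite eq_le critical_le_radius andbT leNgt; apply/negP.
case/lt_EFin_dense=> y ry yB; apply: (no_cvg y ry).
by apply: lt_mx_radius_abs_cvg yB; exact: ltW (lt_trans r0 ry).
Qed.

End SquareMatrix.

End NonnegativeCoefficients.

Section SolutionRadius.
Variables (R : realType) (m : nat).
Variables (A Y : 'cV[fps R[i]]_m) (B : 'M[fps R[i]]_m).
Local Notation C := R[i].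
Local Open Scope complex_scope.

Hypotheses (A_nneg : mx_nneg A) (B_nneg : mx_nneg B).
Hypothesis B0_nil : is_nilpotent (map_mx (@fps_coef0 C) B).
Hypothesis B_rec : ~ is_nilpotent B.
Hypothesis B_conn : forall i j, connect (dependency B) i j.
Hypotheses (YE : Y = A + B *m Y) (Y_neq0 : forall i, Y i 0 != 0) (A_neq0 : A != 0).
Local Notation P := (mx_abs B).

Let Y_nneg : mx_nneg Y := solution_nneg A_nneg B_nneg B0_nil YE.

(* Because c x^k |g|(x) <= |f|(x). *)
Lemma fps_abs_cvg_dominated (f g : fps C) c k x : 0 < c -> 0 < x ->
  (forall n, c * normc (g n) <= normc (f (n + k)%N)) ->
  fps_cvg (fps_abs f) x -> fps_cvg (fps_abs g) x.
Proof.
move=> c0 x0 fg fx; have cx0 : 0 < c * x ^+ k by rewrite mulr_gt0 ?exprn_gt0.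
apply: (fps_series_bounded_cvg (b := fps_eval (fps_abs f) x / (c * x ^+ k))).
- exact: fps_abs_nneg.
- exact: ltW.
move=> N; rewrite ler_pdivlMr //.
apply: le_trans (fps_series_le_eval (k + N) (fps_abs_nneg f) (ltW x0) fx).
rewrite !fps_seriesE big_split_ord /=; apply: ler_wpDl.
  by apply: sumr_ge0 => i _; rewrite mulr_ge0 ?normc_ge0 ?exprn_ge0 // ltW.
rewrite mulr_suml; apply: ler_sum => n _; rewrite (addnC k).
have -> : normc (g n) * x ^+ n * (c * x ^+ k) = c * normc (g n) * x ^+ (n + k).
  by rewrite exprD; ring.
by rewrite ler_wpM2r ?exprn_ge0 ?(ltW x0).
Qed.

Lemma radius_solution_le_A i : (fps_radius (Y i ord0) <= fps_radius (A i ord0))%E.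
Proof.
apply: abs_cvg_radius_le => x x0; apply: (@fps_abs_cvg_dominated _ _ 1 0) => // n.
rewrite mul1r addn0 le_normc ?A_nneg //.
exact: (solution_ge_inhomogeneous A_nneg B_nneg B0_nil YE).
Qed.

Lemma radius_solution_le_B i j : (fps_radius (Y i ord0) <= fps_radius (B i j))%E.
Proof.
have /fps_neq0P[k Yk] := Y_neq0 j; apply: abs_cvg_radius_le => x x0.
apply: (@fps_abs_cvg_dominated _ _ (normc (Y j 0 k)) k) => // [|n].
  by rewrite normc_gt0.
rewrite -normcM mulrC le_normc ?mulr_ge0 ?B_nneg ?Y_nneg //.
exact: (solution_ge_product A_nneg B_nneg B0_nil YE).
Qed.

Lemma radius_solution_dependency i j : dependency B i j ->
  (fps_radius (Y i ord0) <= fps_radius (Y j ord0))%E.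
Proof.
move=> /fps_neq0P[k Bk]; apply: abs_cvg_radius_le => x x0.
apply: (@fps_abs_cvg_dominated _ _ (normc (B i j k)) k) => // [|n].
  by rewrite normc_gt0.
rewrite -normcM le_normc ?mulr_ge0 ?B_nneg ?Y_nneg // addnC.
exact: (solution_ge_product A_nneg B_nneg B0_nil YE).
Qed.

Lemma radius_solutionE i j : fps_radius (Y i j) = mx_radius Y.
Proof.
rewrite ord1; apply/eqP; rewrite eq_le mx_radius_le andbT; apply: le_mx_radius => k l.
rewrite ord1; have /connectP[p] := B_conn i k; elim: p i => [|h p IH] i /=.
  by move=> _ ->.
by case/andP=> Bih pp lastp; apply: le_trans (radius_solution_dependency Bih) (IH _ pp lastp).
Qed.

Lemma mx_radius_solution_le_A : (mx_radius Y <= mx_radius A)%E.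
Proof.
by apply: le_mx_radius => i j; rewrite ord1 -(radius_solutionE i 0) radius_solution_le_A.
Qed.

Lemma mx_radius_solution_le_B : (mx_radius Y <= mx_radius B)%E.
Proof.
by apply: le_mx_radius => i j; rewrite -(radius_solutionE i 0) radius_solution_le_B.
Qed.

Variables (r l : R) (v : 'rV[R]_m) (u : 'cV[R]_m).
Hypothesis crit : critical P r l v u.

Lemma mx_radius_solution_le_critical : (mx_radius Y <= r%:E)%E.
Proof.
have [r0 Br pp l1 _] := crit; have [l_lt1|l_ge1] := ltP l 1.
  by rewrite -(critical_lt1_radius crit l_lt1) mx_radius_solution_le_B.
have le1 : l = 1 by apply/eqP; rewrite eq_le l1.
rewrite leNgt; apply/negP => /(lt_mx_radius_abs_cvg (ltW r0)) Yr.
have absYE : mx_abs Y = mx_abs A + P *m mx_abs Y by rewrite -mx_abs_affine -?YE.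
move: pp; rewrite le1 => pp1; move/eqP: A_neq0; apply.
have /matrixP absA0 := perron1_solution_eq0 (mx_abs_nneg B)
  (mx_abs_coef0_nilpotent B_nneg B0_nil) r0 (mx_abs_nneg A) absYE Br Yr pp1.
apply/matrixP => i j; apply/eqP; rewrite mxE -fps_abs_eq0.
by have /eqP := absA0 i j; rewrite !mxE.
Qed.

Lemma mx_radius_solution : mx_radius Y = mine (mx_radius A) r%:E.
Proof.
have [r0 Br pp l1 _] := crit; apply/eqP; rewrite eq_le le_min.
rewrite mx_radius_solution_le_A mx_radius_solution_le_critical /=.
apply: le_mx_radius => i j; apply: le_fps_radius => x x0.
rewrite lt_min lte_fin => /andP[xA xr].
have Ax := lt_mx_radius_abs_cvg (ltW x0) xA.
have Bx : mx_cvg P x by exact: mx_abs_cvg_le (ltW x0) (ltW xr) Br.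
have [k [v' [u' [pk k1 eq1_critical]]]] := critical_perron_below (mx_abs_nneg B)
  (abs_nonconstant_entry B0_nil B_rec) (abs_connected B_conn) crit x0 (ltW xr).
have k_lt1 : k < 1.
  by rewrite lt_neqAle k1 andbT; apply/eqP => /eq1_critical[xr' _]; rewrite xr' ltxx in xr.
have [v0 _ vE _] := pk.
have vB h : (v' *m mx_eval P x) 0 h <= k * v' 0 h by rewrite vE mxE.
by have /mx_abs_cvgP := solution_abs_cvg (ltW x0) YE Ax Bx v0 k_lt1 vB.
Qed.

End SolutionRadius.

(** * Phases of an eigenvector for the eigenvalue 1 *)

Section Alignment.
Variable R : realType.
Local Notation C := R[i].
Local Notation Re := (@complex.Re R).
Local Open Scope complex_scope.

Lemma aligned_sum (I : finType) (w : I -> C) (b : I -> R) :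
  (forall i, normc (w i) <= b i) -> \sum_i b i <= Re (\sum_i w i) ->
  forall i, w i = (b i)%:C.
Proof.
move=> wb; rewrite Re_sum => sum_le i.
have Re_le k : Re (w k) <= b k by exact: le_trans (Re_le_normc _) (wb k).
have /eqP : \sum_k (b k - Re (w k)) = 0.
  by apply/eqP; rewrite eq_le sumrB subr_le0 sum_le subr_ge0 ler_sum.
rewrite psumr_eq0 => [/allP/(_ i (mem_index_enum i))|k _]; last by rewrite subr_ge0.
rewrite /= subr_eq0 => /eqP bE; have wE : (normc (w i))%:C = w i.
  by apply: normc_le_Re; rewrite -bE.
by rewrite -wE; congr _%:C; apply/eqP; rewrite eq_le wb bE Re_le_normc.
Qed.

Lemma aligned_terms (f : fps C) (c z : C) n : fps_nneg f ->
  fps_cvg (fps_abs f) (normc z) ->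
  c * fps_eval f z = (normc c * fps_eval (fps_abs f) (normc z))%:C ->
  f n != 0 -> c * z ^+ n = (normc c * normc z ^+ n)%:C.
Proof.
move=> f0 fz cf fn; pose head := f n * z ^+ n; pose F := fps_abs f.
have head_norm : normc head = F n * normc z ^+ n by rewrite normcM normcX.
have rest_norm : normc (fps_eval f z - head) <= fps_eval F (normc z) - normc head.
  have := normc_fps_eval_tail n.+1 fz; rewrite !fps_seriesS -/F -head_norm -/head => tail.
  have := normc_fps_series f z n; rewrite -/F => init.
  have -> : fps_eval f z - head = fps_eval f z - (fps_series f z n + head) + fps_series f z n.
    by ring.
  by rewrite (le_trans (le_normcD _ _)) //; lra.
pose w (b : bool) := c * (if b then head else fps_eval f z - head).
pose b (i : bool) := normc c * (if i then normc head else fps_eval F (normc z) - normc head).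
have := @aligned_sum _ w b _ _ true; rewrite /w /b /= => aligned.
have c_head : c * head = (normc c * normc head)%:C.
  apply: aligned => [[]|]; rewrite ?(normcM c) ?ler_wpM2l ?normc_ge0 //.
  by rewrite !big_bool /= -!mulrDr !subrKC cf.
apply: (mulfI fn); rewrite mulrCA -/head c_head head_norm mulrCA rmorphM /=.
by rewrite ge0_normc.
Qed.

End Alignment.

Section Phases.
Variable L : comNzRingType.

Definition phases m (w : L) (d : 'I_m -> L) (M : 'M[fps L]_m) : Prop :=
  forall i j n, M i j n != 0 -> d i * w ^+ n = d j.

Variables (m : nat) (w : L) (d : 'I_m -> L).
Implicit Types M N : 'M[fps L]_m.

Lemma phases1 : phases w d 1%:M.
Proof.
move=> i j n; rewrite mxE; have [<-|_] := eqVneq i j; last by rewrite mulr0n eqxx.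
by case: n => [|n]; rewrite ?eqxx // mulr1.
Qed.

Lemma phasesD M N : phases w d M -> phases w d N -> phases w d (M + N).
Proof.
move=> Mw Nw i j n; rewrite mxE [X in X != 0]/=.
by have [->|/Mw//] := eqVneq (M i j n) 0; rewrite add0r => /Nw.
Qed.

Lemma phasesM M N : phases w d M -> phases w d N -> phases w d (M *m N).
Proof.
move=> Mw Nw i j n; apply: contraNeq => dij; rewrite mx_fps_mulE big1 // => k _.
rewrite big1 // => a _; have [->|/Mw dik] := eqVneq (M i k a) 0; first by rewrite mul0r.
have [->|/Nw dkj] := eqVneq (N k j (n - a)%N) 0; first by rewrite mulr0.
by rewrite -dkj -dik -mulrA -exprD subnKC ?eqxx // -ltnS in dij.
Qed.

Lemma phases_invmx_1B M : is_nilpotent (map_mx (@fps_coef0 L) M) ->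
  phases w d M -> phases w d (invmx (1%:M - M)).
Proof.
move=> M0_nil Mw i j n; have [k /exp_coef_eq0 Mk] := M0_nil.
have phases_exp h : phases w d (M ^+ h).
  by elim: h => [|h IH]; [exact: phases1|rewrite exprS; exact: phasesM].
have phases_sum t : phases w d (\sum_(h < t) M ^+ h).
  elim: t => [|t IH]; first by rewrite big_ord0 => i' j' a; rewrite mxE eqxx.
  by rewrite big_ord_recr; exact: phasesD.
rewrite (neumann_expansion (k * n.+1) (invmx_1BE M0_nil)) mulmx1 mxE [X in X != 0]/=.
rewrite [fun_of_matrix (M ^+ _ *m _) i j n]mulmx_coef_eq0 ?addr0 => [|i' j' a an].
  exact: phases_sum.
by apply: (Mk n.+1); rewrite ?ltnS.
Qed.

End Phases.

Section ResolventPeriod.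
Variables (R : realType) (m : nat) (B : 'M[fps R[i]]_m).
Local Notation C := R[i].
Local Notation F := (invmx (1%:M - B)).

Hypothesis B_nneg : mx_nneg B.
Hypothesis B0_nil : is_nilpotent (map_mx (@fps_coef0 C) B).
Hypothesis B_rec : ~ is_nilpotent B.
Hypothesis B_conn : forall i j, connect (dependency B) i j.

Let FE : F = 1%:M + B *m F := invmx_1BE B0_nil.
Let one_nneg : mx_nneg (1%:M : 'M[fps C]_m) := @mx_nneg1 _ m.
Let F_nneg : mx_nneg F := solution_nneg one_nneg B_nneg B0_nil FE.

Lemma resolvent_diag0_neq0 i : F i i 0%N != 0.
Proof.
have := solution_ge_inhomogeneous one_nneg B_nneg B0_nil FE i i 0.
rewrite mxE eqxx => one_le; apply: lt0r_neq0; apply: lt_le_trans one_le.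
exact: ltr01.
Qed.

Lemma resolvent_product_neq0 i k j a b :
  B i k a != 0 -> F k j b != 0 -> F i j (a + b)%N != 0.
Proof.
move=> Ba Fb; apply: lt0r_neq0.
apply: lt_le_trans (solution_ge_product one_nneg B_nneg B0_nil FE i k j a b).
by rewrite mulr_gt0 // lt_def ?Ba ?Fb ?B_nneg ?F_nneg.
Qed.

Lemma resolvent_neq0 i j : exists n, F i j n != 0.
Proof.
have /connectP[p] := B_conn i j; elim: p i => [|k p IH] i /=.
  by move=> _ ->; exists 0%N; exact: resolvent_diag0_neq0.
case/andP=> /fps_neq0P[a Ba] pp /(IH _ pp)[b Fb].
by exists (a + b)%N; exact: resolvent_product_neq0 Ba Fb.
Qed.

Lemma qB_gt0 : (0 < qB B)%N.
Proof.
rewrite /qB; case: ifP => [|_]; first by rewrite lt0n.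
have [i [j [n [n0 Bn]]]] := exists_nonconstant_entry B0_nil B_rec.
have [b Fb] := resolvent_neq0 j i; have Fnb := resolvent_product_neq0 Bn Fb.
have [_ /(_ 0%N (resolvent_diag0_neq0 i))] := fps_valP Fnb.
rewrite leqn0 => /eqP val0; have := fps_period_dvd Fnb; rewrite val0 subn0 => period_dvd.
have period0 : (0 < fps_period (F i i))%N by apply: dvdn_gt0 period_dvd; rewrite addn_gt0 n0.
by apply: dvdn_gt0 period0 _; apply: biggcdn_inf (dvdnn _).
Qed.

(* The phases of B are phases of its resolvent, where d i w^n = d i on the
   diagonal forces w^n = 1. *)
Lemma expr_qB_phases (w : C) (d : 'I_m -> C) : w != 0 -> (forall i, d i != 0) ->
  phases w d B -> w ^+ qB B = 1.
Proof.
move=> w0 d0 Bw; have [e eP] := exists_expr_order w.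
have Fw := phases_invmx_1B B0_nil Bw.
apply/eqP; rewrite eP /qB; case: ifP => _; last first.
  apply/dvdn_biggcdP => i _; apply: (expr_dvdn_fps_period w0 eP) => n k Fn Fk.
  by apply: (mulfI (d0 i)); rewrite (Fw i i n Fn) (Fw i i k Fk).
apply/dvdn_biggcdP => i _; apply/dvdn_biggcdP => j _.
apply: (expr_dvdn_fps_period w0 eP) => n k Bn Bk.
by apply: (mulfI (d0 i)); rewrite (Bw i j n Bn) (Bw i j k Bk).
Qed.

End ResolventPeriod.

Section EigenvectorPhases.
Variables (R : realType) (m : nat) (B : 'M[fps R[i]]_m).
Local Notation C := R[i].
Local Open Scope complex_scope.
Variables (z : C) (l : R) (v : 'rV[R]_m) (u : 'cV[R]_m) (y : 'rV[C]_m).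
Local Notation M := (mx_eval (mx_abs B) (normc z)).

Hypotheses (B_nneg : mx_nneg B) (Bz : mx_cvg (mx_abs B) (normc z)).
Hypotheses (M_irr : irreducible_mx M) (M_perron : perron_pair M l v u) (l1 : l <= 1).
Hypotheses (y_neq0 : y != 0) (yE : y *m mx_eval B z = y).

Let a : 'rV[R]_m := \row_i normc (y 0 i).

Lemma normc_eigenvector_subeigen : subeigen M 1 a.
Proof.
split=> [i||j]; first by rewrite mxE normc_ge0.
  by have /rV0Pn[i yi] := y_neq0; apply/rV0Pn; exists i; rewrite mxE normc_eq0.
rewrite mul1r [leLHS]mxE -[in leLHS]yE [in leLHS]mxE [leRHS]mxE.
apply: le_trans (normc_sum _ _ _) _; apply: ler_sum => i _.
rewrite [mx_eval B z i j]mxE [a 0 i]mxE mx_eval_absE normcM ler_wpM2l ?normc_ge0 //.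
by apply: normc_fps_eval; move/mx_abs_cvgP: Bz.
Qed.

Lemma eigenvector_perron_eq1 : l = 1.
Proof.
by apply/eqP; rewrite eq_le l1; exact: perron_subeigen M_perron normc_eigenvector_subeigen.
Qed.

Lemma normc_eigenvectorE : a *m M = a.
Proof.
have := max_subeigen_eigen M_irr normc_eigenvector_subeigen; rewrite scale1r; apply.
by move=> k w kw; rewrite -eigenvector_perron_eq1; exact: perron_subeigen M_perron kw.
Qed.

Lemma normc_eigenvector_gt0 i : 0 < normc (y 0 i).
Proof.
have [a0 an _] := normc_eigenvector_subeigen.
have aM_le j : (a *m M) 0 j <= 1 * a 0 j by rewrite normc_eigenvectorE mul1r.
by have := subinvariant_gt0 M_irr a0 an aM_le i; rewrite mxE.
Qed.

(* Equality in |y| <= |y| |B(z)| <= |y| B(|z|) forces all the terms of all the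
   series to have the same argument, up to the phases of y. *)
Lemma eigenvector_phases : 0 < normc z ->
  phases (z / (normc z)%:C) (fun i => y 0 i / (normc (y 0 i))%:C) B.
Proof.
move=> z0 i j n Bn; have y0 k := normc_eigenvector_gt0 k.
have yj0 : y 0 j != 0 by rewrite -normc_gt0.
pose e := (normc (y 0 j))%:C / y 0 j.
have e_norm : normc e = 1.
  by rewrite normcM normcV normc_real ger0_norm ?normc_ge0 // divff // gt_eqF.
pose c k := e * y 0 k; have c_norm k : normc (c k) = normc (y 0 k).
  by rewrite normcM e_norm mul1r.
have /mx_abs_cvgP Bz' := Bz.
have term k : c k * fps_eval (B k j) z =
    (normc (c k) * fps_eval (fps_abs (B k j)) (normc z))%:C.
  apply: (aligned_sum (w := fun h => c h * fps_eval (B h j) z)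
    (b := fun h => normc (c h) * fps_eval (fps_abs (B h j)) (normc z))) => [h|].
    by rewrite normcM ler_wpM2l ?normc_ge0 ?normc_fps_eval.
  have -> : \sum_h c h * fps_eval (B h j) z = (normc (y 0 j))%:C.
    transitivity (e * y 0 j); last by rewrite divfK.
    rewrite -[in RHS]yE [in RHS]mxE mulr_sumr.
    by apply: eq_bigr => h _; rewrite mulrA mxE.
  rewrite /=; have /matrixP/(_ 0 j) := normc_eigenvectorE.
  rewrite [RHS]mxE => <-; rewrite mxE le_eqVlt; apply/orP; left; apply/eqP.
  by apply: eq_bigr => h _; rewrite c_norm mxE mx_eval_absE.
have := aligned_terms (B_nneg i j) (Bz' i j) (term i) Bn.
rewrite c_norm rmorphM rmorphXn /= /c => cz.
have [[zC yiC] yjC] := (gt0_realC_neq0 z0, gt0_realC_neq0 (y0 i), gt0_realC_neq0 (y0 j)).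
rewrite expr_div_n.
apply: (@mulfI _ (e * (normc (y 0 i))%:C * (normc z)%:C ^+ n)).
  by rewrite !mulf_neq0 ?invr_eq0 ?expf_neq0.
transitivity (e * y 0 i * z ^+ n); first by rewrite /e; field; rewrite yj0 yiC expf_neq0.
by rewrite cz /e; field; rewrite yj0 yjC.
Qed.

End EigenvectorPhases.

(** * Irreducible linear systems *)

Section CriticalRadius.
Variables (R : realType) (m : nat) (B : 'M[fps R[i]]_m).
Local Open Scope complex_scope.

Hypotheses (B_nneg : mx_nneg B) (B0_nil : is_nilpotent (map_mx (@fps_coef0 R[i]) B)).
Hypotheses (B_rec : ~ is_nilpotent B) (B_conn : forall i j, connect (dependency B) i j).
Local Notation P := (mx_abs B).

Let P_nneg : mx_nneg P := mx_abs_nneg B.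
Let P_nonconst : exists i j n, (0 < n)%N /\ P i j n != 0 :=
  abs_nonconstant_entry B0_nil B_rec.
Let P_conn : forall i j, connect (mx_dependency P) i j := abs_connected B_conn.

Lemma perron_pair_largest x l v u : 0 < x -> mx_cvg P x ->
  perron_pair (mx_eval P x) l v u -> largest_real_eigenvalue (mx_eval B x%:C) l.
Proof.
move=> x0 Px pp; rewrite (mx_eval_nneg B_nneg (ltW x0) Px).
apply: (perron_largest_eigenvalue _ _ pp); first exact: nonconstant_dim_gt0 P_nonconst.
exact: (mx_eval_ge0 P_nneg (ltW x0) Px).
Qed.

Lemma largest_real_eigenvalue_unique n (M : 'M[R[i]]_n) (k l : R) :
  largest_real_eigenvalue M k -> largest_real_eigenvalue M l -> k = l.
Proof. by move=> [Mk k_max] [Ml l_max]; apply/eqP; rewrite eq_le l_max // k_max. Qed.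

Lemma subcritical_critical : (0 < mx_radius B)%E -> subcritical B ->
  exists r l v u, critical P r l v u /\ l < 1.
Proof.
move=> B_radius [r [rE Br [l' l'_largest l'1]]].
have r0 : 0 < r by rewrite -lte_fin -rE.
have Pr := (mx_cvg_nneg B_nneg (ltW r0)).1 Br.
have [l [v [u pp]]] := exists_perron_pair_eval P_nneg P_nonconst P_conn r0 Pr.
have l1 : l < 1.
  by rewrite (largest_real_eigenvalue_unique (perron_pair_largest r0 Pr pp) l'_largest).
exists r, l, v, u; split=> //; split=> //; first exact: ltW.
move=> _ y ry /(mx_abs_cvg_le_radius (ltW (lt_trans r0 ry))).
by rewrite rE lee_fin leNgt ry.
Qed.

Lemma not_subcritical_critical : (0 < mx_radius B)%E -> ~ subcritical B ->
  exists r v u, critical P r 1 v u.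
Proof.
move=> /lt_EFin_dense[y y0 /(lt_mx_radius_abs_cvg (ltW y0)) Py] nsub.
have P0_nil := mx_abs_coef0_nilpotent B_nneg B0_nil.
have [r [l [v [u crit]]]] := exists_critical P_nneg P0_nil P_nonconst P_conn y0 Py.
exists r, v, u; have [r0 Pr pp l1 _] := crit; suff <- : l = 1 by [].
apply/eqP; rewrite eq_le l1 leNgt; apply/negP => l_lt1; apply: nsub.
exists r; split; first exact: critical_lt1_radius crit l_lt1.
  exact: (mx_cvg_nneg B_nneg (ltW r0)).2 Pr.
by exists l => //; exact: perron_pair_largest pp.
Qed.

Lemma critical_unique_rhoC r v u : critical P r 1 v u -> unique (is_rhoC B) r.
Proof.
move=> crit; have [r0 Pr pp _ _] := crit; split.
  split=> //; first exact: critical_le_radius crit.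
    exact: (mx_cvg_nneg B_nneg (ltW r0)).2 Pr.
  exact: perron_pair_largest pp.
move=> s [s0 _ /(mx_cvg_nneg B_nneg (ltW s0)).1 Ps s_largest].
have [k [v' [u' pk]]] := exists_perron_pair_eval P_nneg P_nonconst P_conn s0 Ps.
have k1 := largest_real_eigenvalue_unique (perron_pair_largest s0 Ps pk) s_largest.
rewrite k1 in pk; apply/eqP; rewrite eq_le !leNgt; apply/andP; split; apply/negP => h.
  by have := perron_eval_lt P_nneg P_nonconst (ltW s0) h Pr pk pp; rewrite ltxx.
by have := perron_eval_lt P_nneg P_nonconst (ltW r0) h Ps pp pk; rewrite ltxx.
Qed.

Lemma eigenvalue1_SigmaC r l v u z (y : 'rV[R[i]]_m) : critical P r l v u ->
  0 < normc z -> normc z <= r -> y != 0 -> y *m mx_eval B z = y ->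
  [/\ l = 1, r = normc z & SigmaC B r z].
Proof.
move=> crit z0 zr y_neq0 yE; have [r0 Pr _ _ _] := crit.
have Pz := mx_abs_cvg_le (ltW z0) zr Pr.
have Pz_irr := irreducible_mx_eval P_nneg P_conn z0 Pz.
have [k [v' [u' [pk k1 eq1_critical]]]] :=
  critical_perron_below P_nneg P_nonconst P_conn crit z0 zr.
have [zrE l1] := eq1_critical (eigenvector_perron_eq1 Pz pk k1 y_neq0 yE); split=> //.
have w_neq0 : z / (normc z)%:C != 0.
  by rewrite mulf_neq0 ?invr_eq0 ?gt0_realC_neq0 // -normc_gt0.
have d_neq0 i : y 0 i / (normc (y 0 i))%:C != 0.
  have yi := normc_eigenvector_gt0 Pz Pz_irr pk k1 y_neq0 yE i.
  by rewrite mulf_neq0 ?invr_eq0 ?gt0_realC_neq0 // -normc_gt0.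
have Bphases := eigenvector_phases B_nneg Pz Pz_irr pk k1 y_neq0 yE z0.
have wq := expr_qB_phases B0_nil w_neq0 d_neq0 Bphases.
have [k' k'q wE] := root_of_unity_expi (qB_gt0 B_nneg B0_nil B_rec B_conn) wq.
by exists k' => //; rewrite -wE -zrE mulrCA divff ?mulr1 // gt0_realC_neq0.
Qed.

End CriticalRadius.

Section IrreducibleSystem.
Variables (R : realType) (m : nat).
Variables (A Y : 'cV[fps R[i]]_m) (B : 'M[fps R[i]]_m).
Local Open Scope complex_scope.
Hypotheses (irr : irreducible_system A B) (sol : gf_solution A B Y).

Lemma system_A_nneg : mx_nneg A.
Proof. by have [[_ [A0 _] _ _] _ _ _] := irr => i j n; rewrite ord1. Qed.

Lemma system_B_nneg : mx_nneg B.
Proof. by have [[_ [_ B0] _ _] _ _ _] := irr. Qed.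

Lemma system_B0_nilpotent : is_nilpotent (map_mx (@fps_coef0 R[i]) B).
Proof. by have [[_ _ _]] := irr; rewrite /lin_jacobian mx_eval0. Qed.

Lemma system_A_neq0 : A != 0.
Proof.
have [_ zf Brec _] := irr; apply/eqP => A0.
have lin_U0 k : lin_U A B k = 0.
  by elim: k => //= k ->; rewrite /lin_H mulmx0 addr0 A0 mx_eval0 raddf0.
have sol0 : gf_solution A B 0.
  split; last 2 first.
  - by rewrite A0 mulmx0 addr0.
  - by rewrite lin_U0 mx_eval0 raddf0.
  apply: lt_le_trans (_ : 1%:E <= _)%E; first by rewrite lte_fin.
  apply: mx_abs_cvg_le_radius => //; apply/mx_abs_cvgP => i j.
  by rewrite mxE -(raddf0 (@fpsC _)); exact: fps_abs_cvgC.
have [i _] := exists_nonconstant_entry system_B0_nilpotent Brec.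
by have /eqP := zf 0 sol0 i; rewrite mxE.
Qed.

Variables (r l : R) (v : 'rV[R]_m) (u : 'cV[R]_m).
Hypothesis crit : critical (mx_abs B) r l v u.

Lemma system_radius : mx_radius Y = mine (mx_radius A) r%:E.
Proof.
have [_ zf Brec Bconn] := irr; have [_ YE _] := sol.
exact: (mx_radius_solution system_A_nneg system_B_nneg system_B0_nilpotent Brec Bconn YE
  (zf Y sol) system_A_neq0 crit).
Qed.

Lemma system_dominant_sing z : dominant_sing Y z ->
  [\/ mx_radius A = mx_radius Y /\ dominant_sing A z,
      mx_radius B = mx_radius Y /\ dominant_sing B z |
      [/\ l = 1, r%:E = mx_radius Y & SigmaC B r z] ].
Proof.
have [_ zf Brec Bconn] := irr; have [Y_radius YE _] := sol; have [_ Br _ _ _] := crit.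
have [A_nneg B_nneg] := (system_A_nneg, system_B_nneg).
have B0_nil := system_B0_nilpotent; have Y_neq0 := zf Y sol.
have YA := mx_radius_solution_le_A A_nneg B_nneg B0_nil Bconn YE.
have YB := mx_radius_solution_le_B A_nneg B_nneg B0_nil Bconn YE Y_neq0.
have YrE := radius_solutionE A_nneg B_nneg B0_nil Bconn YE.
move=> [zY [i [j not_regular]]].
have z0 : 0 < normc z by rewrite -lte_fin zY; exact: Y_radius.
have zr : normc z <= r.
  by rewrite -lee_fin zY system_radius ge_min lexx orbT.
have [singA|/not_dominant_sing_regular regA] := pselect (dominant_sing A z).
  by constructor 1; split; [rewrite -zY; have [] := singA|exact: singA].
have [singB|/not_dominant_sing_regular regB] := pselect (dominant_sing B z).
  by constructor 2; split; [rewrite -zY; have [] := singB|exact: singB].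
have [/det0P[y y_neq0]|det_neq0] := boolP (\det (1%:M - mx_eval B z) == 0); last first.
  have unit_1B : 1%:M - mx_eval B z \in unitmx by rewrite unitmxE unitfE.
  have zY_le : ((normc z)%:E <= mx_radius Y)%E by rewrite zY lexx.
  have Bz := mx_abs_cvg_le (ltW z0) zr Br.
  case: not_regular; apply: (solution_regular YE z0 YA YB zY_le Bz unit_1B YrE).
    exact: regA (le_trans zY_le YA).
  exact: regB (le_trans zY_le YB).
rewrite mulmxBr mulmx1 => /subr0_eq/esym yE; constructor 3.
have [l1 rz Cz] := eigenvalue1_SigmaC B_nneg B0_nil Brec Bconn crit z0 zr y_neq0 yE.
by split; [exact: l1|rewrite rz zY|exact: Cz].
Qed.

End IrreducibleSystem.

Theorem theorem6p4 (R : realType) (m : nat)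
    (A : 'cV[fps R[i]]_m) (B : 'M[fps R[i]]_m) (Y : 'cV[fps R[i]]_m) :
  irreducible_system A B -> gf_solution A B Y ->
  let rhoA := mx_radius A in
  let rhoB := mx_radius B in
  let rhoY := mx_radius Y in
  let conclusion (rhoC : \bar R) (SC : set R[i]) : Prop :=
    rhoY = mine rhoA (mine rhoB rhoC) /\
    dominant_sing Y `<=`
      [set z | rhoA = rhoY /\ dominant_sing A z] `|`
      [set z | rhoB = rhoY /\ dominant_sing B z] `|`
      [set z | rhoC = rhoY /\ SC z] in
  (subcritical B -> conclusion +oo%E set0) /\
  (~ subcritical B ->
    exists2 rhoC : R, unique (is_rhoC B) rhoC &
      conclusion rhoC%:E (SigmaC B rhoC)).
Proof.
move=> irr sol rhoA rhoB rhoY conclusion.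
have [[[_ B_radius] _ _ _] _ Brec Bconn] := irr.
have [B_nneg B0_nil] := (system_B_nneg irr, system_B0_nilpotent irr).
split=> [sub|nsub].
  have [r [l [v [u [crit l1]]]]] :=
    subcritical_critical B_nneg B0_nil Brec Bconn B_radius sub.
  split=> [|z /(system_dominant_sing irr sol crit)[singA|singB|[le1 _ _]]].
  - by rewrite /rhoY (system_radius irr sol crit) miney /rhoB (critical_lt1_radius crit l1).
  - by left; left.
  - by left; right.
  - by rewrite le1 ltxx in l1.
have [r [v [u crit]]] := not_subcritical_critical B_nneg B0_nil Brec Bconn B_radius nsub.
exists r; first exact: (critical_unique_rhoC B_nneg B0_nil Brec Bconn crit).
split=> [|z /(system_dominant_sing irr sol crit)[singA|singB|[_ rY Cz]]].
- rewrite /rhoY (system_radius irr sol crit); congr mine.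
  exact/esym/min_idPr/(critical_le_radius crit).
- by left; left.
- by left; right.
- by right.
Qed.
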